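(* Let $\kappa=4$. The best (smallest) constant $C_P$ such that $$\int_{\mathbb{R}}u^2\,d\nu-\Big(\int_{\mathbb{R}}u\,d\nu\Big)^2\le C_P\int_{\mathbb{R}}(u')^2\,d\nu\quad\text{for all }u\in H^1(\nu)$$ satisfies $C_P\in[\,33.58004242-2.3\times10^{-7},\ 33.58004242+2.3\times10^{-7}\,]$.
   Context: Let $V(x)=\frac{x^4}{4}-\kappa\frac{x^2}{2}$, $Z=\int_{\mathbb{R}}e^{-V(x)}dx$, and $\nu(dx)=e^{-V(x)}dx/Z$. Let $H^1(\nu)=\{u\in L^2(\nu):u'\in L^2(\nu)\}$ with $u'$ the weak derivative. *)

(* Defs.v *)
From HB Require Import structures.
From mathcomp Require Import all_boot all_order all_algebra.
From mathcomp Require Import all_classical all_reals all_analysis.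
Set Implicit Arguments. Unset Strict Implicit. Unset Printing Implicit Defensive.
Import Order.TTheory GRing.Theory Num.Theory.
Import numFieldNormedType.Exports.
Local Open Scope classical_set_scope.
Local Open Scope ring_scope.

Section Defs.
Context {R : realType}.

Definition kappa : R := 4.

Definition V (x : R) : R := x ^+ 4 / 4 - kappa * x ^+ 2 / 2.

Definition dens (x : R) : R := expR (- V x).

Definition Z : R := Rintegral lebesgue_measure setT dens.

Definition nu_int (f : R -> R) : R :=
  Rintegral lebesgue_measure setT (fun x => f x * dens x) / Z.

Definition L2nu (f : R -> R) : Prop :=
  measurable_fun setT f /\
  (\int[lebesgue_measure]_x (((f x) ^+ 2 * dens x)%:E) < +oo)%E.

Definition test_fun (phi : R -> R) : Prop :=
  (forall (n : nat) (x : R), derivable (derive1n n phi) x 1) /\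
  exists M : R, forall x : R, M < `|x| -> phi x = 0.

Definition weak_derivative (u du : R -> R) : Prop :=
  locally_integrable setT u /\ locally_integrable setT du /\
  forall phi, test_fun phi ->
    Rintegral lebesgue_measure setT (fun x => u x * derive1 phi x) =
    - Rintegral lebesgue_measure setT (fun x => du x * phi x).

Definition H1nu (u du : R -> R) : Prop :=
  L2nu u /\ weak_derivative u du /\ L2nu du.

Definition poincare_const (C : R) : Prop :=
  forall u du : R -> R, H1nu u du ->
    nu_int (fun x => u x ^+ 2) - (nu_int u) ^+ 2 <=
    C * nu_int (fun x => du x ^+ 2).

Definition CP_center : R := (3358%:R * 10 ^+ 6 + 4242%:R) / 10 ^+ 8.
Definition CP_err : R := 23%:R / 10 ^+ 8.

End Defs.

(* Main.v *)
Require Import Defs.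
From HB Require Import structures.
From Stdlib Require Import ZArith.
From mathcomp Require Import all_boot all_order all_algebra.
From mathcomp Require Import all_classical all_reals all_analysis.
From mathcomp Require Import measurable_realfun.
From mathcomp Require Import ring lra ssrZ.
Set Implicit Arguments. Unset Strict Implicit. Unset Printing Implicit Defensive.
Import Order.TTheory GRing.Theory Num.Theory.
Import numFieldNormedType.Exports.
Local Open Scope classical_set_scope.
Local Open Scope ring_scope.

(* Upper bound. Let [f] be odd with [w = f' > 0] and [f <= C (V' w - w')] on the positive half-line.
   Integrating against [exp (- V)] gives [int_t^oo f exp (- V) <= C w(t) exp (- V(t))], while
   Cauchy-Schwarz gives [(u(x) - u(0))^2 <= f(x) int_0^x u'^2 / w]. Integrating the latter in [x] and
   exchanging the integrals yields [Var u <= nu ((u - u(0))^2) <= C nu (u'^2)].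
   Lower bound. Let [f] be odd with [f' = 0] at [X] and [c f (V' f' - f'') <= f^2] on [[-X, X]]. Then [f],
   continued by constants, has mean zero and satisfies [c nu (f'^2) <= nu (f^2)].
   In both cases [f x = x q(x^2)], where the polynomial [q] is a truncated, rounded Chebyshev expansion of
   the solution of the eigenvalue equation [f'' = V' f' - f / C] for [C] close to the optimal constant,
   33.580042199. The two differential inequalities then become sign conditions on polynomials with
   integer coefficients, which are checked by subdivision. *)

(** * Calculus on the line and the Gibbs density *)

(** On the odd increasing eigenfunction both differential inequalities are equalities, so neither
    method loses anything in the limit. Solving the equation with a constant below the claimed upper
    bound, or above the claimed lower bound, makes the inequality strict with a slack proportional
    to [f], and this slack absorbs truncation and rounding. It vanishes at 0 together with [f];
    dividing out the factor [x] of an odd function leaves a strict sign for the subdivision to find.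
    A polynomial imitates the eigenfunction only on a bounded interval, so each side needs a
    continuation past [X]. For the upper bound the slope is frozen: [f] becomes linear and stays a
    supersolution because [V'] grows at least as fast as [x] there and [C >= 1]. For the lower bound
    the value is frozen, which asks for [f' = 0] at [X] exactly and forfeits the mass beyond [X]. A
    weakly differentiable [u] has no canonical value at 0; the lemma of du Bois-Reymond supplies a
    constant in its place. The best constant is the infimum of the admissible ones, which is
    attained. *)

Lemma is_derive_continuous (R : realType) (f : R -> R) (x d : R) :
  is_derive x 1 f d -> {for x, continuous f}.
Proof. by move=> [+ _]; move/derivable1_diffP/differentiable_continuous. Qed.

Section Calculus.
Context {R : realType}.
Notation mu := (@lebesgue_measure R).
Implicit Types (f F g : R -> R) (a b x : R).

Lemma is_derive_continuousT f F : (forall x : R, is_derive x 1 F (f x)) -> continuous F.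
Proof. by move=> dF x; exact: is_derive_continuous (dF x). Qed.

Lemma is_derive_derive1 f F : (forall x : R, is_derive x 1 F (f x)) -> derive1 F = f.
Proof. by move=> dF; apply/funext => x; rewrite derive1E; exact: derive_val. Qed.

Lemma is_derive_LRcontinuous f F a b : (forall x : R, is_derive x 1 F (f x)) ->
  derivable_oo_LRcontinuous F a b.
Proof.
move=> dF; have cF := is_derive_continuousT dF; split.
- by move=> x _; have [] := dF x.
- exact: cvg_at_right_filter (cF a).
- exact: cvg_at_left_filter (cF b).
Qed.

Lemma FTC_itv f F a b : a <= b -> continuous f ->
  (forall x : R, is_derive x 1 F (f x)) ->
  (\int[mu]_(x in `[a, b]) (f x)%:E = (F b - F a)%:E)%E.
Proof.
rewrite le_eqVlt => /predU1P[<- _ _|ab cf dF].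
  by rewrite set_itv1 integral_set1 subrr.
rewrite (@continuous_FTC2 _ _ F)//.
- exact: continuous_subspaceT.
- exact: is_derive_LRcontinuous dF.
- by move=> x _; rewrite (is_derive_derive1 dF).
Qed.

Lemma ge0_FTC_ray f F a (l : R) : (forall x, a <= x -> 0 <= f x) -> continuous f ->
  (forall x : R, is_derive x 1 F (f x)) -> F x @[x --> +oo] --> l ->
  (\int[mu]_(x in `[a, +oo[) (f x)%:E = (l - F a)%:E)%E.
Proof.
move=> f0 cf dF Fl; have cF := is_derive_continuousT dF; rewrite EFinB; apply: (ge0_continuous_FTC2y f0 _ Fl).
- exact: continuous_subspaceT.
- by move=> x _; have [] := dF x.
- exact: cvg_at_right_filter (cF a).
- by move=> x _; rewrite (is_derive_derive1 dF).
Qed.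

(** The derivative is an explicit argument, so that later derivatives can be matched by [congr]
    followed by [ring]. *)
Lemma is_derive_mul f g a b x : is_derive x 1 f a -> is_derive x 1 g b ->
  is_derive x 1 (fun y => f y * g y) (a * g x + f x * b).
Proof.
move=> df dg; have := is_deriveM df dg.
by congr (is_derive _ _ _ _); rewrite /GRing.scale /=; ring.
Qed.

Lemma is_derive_add f g a b x : is_derive x 1 f a -> is_derive x 1 g b ->
  is_derive x 1 (fun y => f y + g y) (a + b).
Proof. by move=> df dg; exact: is_deriveD df dg. Qed.

Lemma continuousMR f g : continuous f -> continuous g -> continuous (fun y => f y * g y).
Proof. by move=> cf cg x; apply: cvgM; [exact: cf|exact: cg]. Qed.

Lemma continuousDR f g : continuous f -> continuous g -> continuous (fun y => f y + g y).
Proof. by move=> cf cg x; apply: cvgD; [exact: cf|exact: cg]. Qed.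

Lemma continuousNR f : continuous f -> continuous (fun y => - f y).
Proof. by move=> cf x; apply: cvgN; exact: cf. Qed.

Lemma continuousXR f n : continuous f -> continuous (fun y => f y ^+ n).
Proof.
move=> cf; elim: n => [|n IHn]; first by move=> x; exact: cvg_cst.
have -> : (fun y => f y ^+ n.+1) = (fun y => f y * f y ^+ n) by apply/funext => y; exact: exprS.
exact: continuousMR.
Qed.

Lemma measurable_continuous (f : R -> R) (D : set R) : continuous f -> measurable_fun D f.
Proof. by move=> cf; apply: measurable_funTS; exact: continuous_measurable_fun. Qed.

Lemma measurable_EFin_continuous (f : R -> R) (D : set R) :
  continuous f -> measurable_fun D (fun x => (f x)%:E).
Proof. by move=> cf; apply/measurable_EFinP; exact: measurable_continuous. Qed.

Definition dV (x : R) : R := x ^+ 3 - 4 * x.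

Lemma continuous_dV : continuous dV.
Proof.
apply: continuousDR; first by apply: continuousXR => x; exact: cvg_id.
apply: continuousNR; apply: continuousMR => x; [exact: cvg_cst|exact: cvg_id].
Qed.

Lemma is_derive_dens x : is_derive x 1 dens (- dV x * dens x).
Proof.
have dc (c : R) : is_derive x 1 (fun=> c) 0 by exact: is_derive_cst.
have d2 := is_derive_mul (is_derive_id x (1 : R)) (is_derive_id x (1 : R)).
have H : is_derive x 1 (fun y : R => - V y) (- dV x).
  have := is_derive_add (is_derive_mul (dc (- 4^-1)) (is_derive_mul d2 d2)) (is_derive_mul (dc 2) d2).
  congr (is_derive _ _ _ _); last by rewrite /dV /=; field.
  by apply/funext => y; rewrite /V /kappa /=; field.
have := @is_derive1_comp R expR (fun y => - V y) x _ _ (is_derive_expR _) H.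
by congr (is_derive _ _ _ _); rewrite /dens mulrC.
Qed.

Lemma continuous_dens : continuous (@dens R).
Proof. exact: is_derive_continuousT is_derive_dens. Qed.

Lemma dens_gt0 x : 0 < dens x. Proof. exact: expR_gt0. Qed.

Lemma dens_ge0 x : 0 <= dens x. Proof. exact: expR_ge0. Qed.

Lemma densN x : dens (- x) = dens x.
Proof.
have VN : V (- x) = V x by rewrite /V; ring.
by rewrite /dens VN.
Qed.

(** Completing the square: [V x - x^2 + 9 = (x^2 / 2 - 3)^2]. The Gaussian bound gives both
    integrability of the density and its decay at infinity. *)
Lemma dens_le_gauss x : dens x <= expR 9 * gauss_fun x.
Proof.
rewrite /dens /gauss_fun -expRD ler_expR /V /kappa.
have := sqr_ge0 (x ^+ 2 / 2 - 3); rewrite -subr_ge0 => H; rewrite -subr_ge0.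
by move: H; congr (0 <= _); field.
Qed.

Lemma integrable_dens : mu.-integrable [set: R] (EFin \o dens).
Proof.
apply: (le_integrable measurableT _ _ (integrableZl measurableT (expR 9) integrableT_gauss)).
  exact: measurable_EFin_continuous continuous_dens.
move=> x _ /=; rewrite lee_fin ger0_norm ?dens_ge0// ger0_norm ?dens_le_gauss//.
by rewrite mulr_ge0 ?expR_ge0.
Qed.

Lemma cvg_dens : (dens x : R) @[x --> +oo] --> (0 : R).
Proof.
have H : (expR 9 * gauss_fun x : R) @[x --> +oo] --> (0 : R).
  rewrite -[X in _ --> X](mulr0 (expR 9)); apply: cvgM; [exact: cvg_cst|exact: cvg_gauss_fun].
apply: squeeze_cvgr (cvg_cst (0 : R)) H.
by near=> x; rewrite dens_ge0 dens_le_gauss.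
Unshelve. all: by end_near. Qed.

Lemma int_dens_gt0 : 0 < @Defs.Z R.
Proof.
have dens_ge : forall x, 0 <= x <= 1 -> expR (- (1 / 4)) <= dens x.
  move=> x /andP[x0 x1]; rewrite ler_expR lerN2 /V /kappa.
  have : 0 <= x ^+ 2 by rewrite sqr_ge0.
  have : x ^+ 4 <= 1 by rewrite exprn_ile1.
  lra.
rewrite /Defs.Z /Rintegral fine_gt0//; apply/andP; split; last first.
  have /integrableP[_] := integrable_dens.
  by congr (_ < _)%E; apply: eq_integral => x _; rewrite gee0_abs ?lee_fin ?dens_ge0.
apply: lt_le_trans (_ : (\int[mu]_(x in `[0%R, 1%R]) (expR (- (1 / 4)) : R)%:E <= _)%E).
  have mu01 : mu `[0%R, 1%R]%classic = 1%E.
    by rewrite lebesgue_measure_itv/= lte_fin ltr01 oppr0 adde0.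
  rewrite integral_cst//= mu01 mule1.
  by rewrite lte_fin expR_gt0.
apply: le_trans (_ : (\int[mu]_(x in `[0%R, 1%R]) (dens x)%:E <= _)%E).
  apply: ge0_le_integral; first exact: measurable_itv.
  - by move=> x _; rewrite lee_fin expR_ge0.
  - exact: measurable_cst.
  - exact: measurable_EFin_continuous continuous_dens.
  - by move=> x; rewrite /= in_itv/= lee_fin => /dens_ge.
apply: ge0_subset_integral => //.
- exact: measurable_EFin_continuous continuous_dens.
- by move=> x _; rewrite lee_fin dens_ge0.
Qed.

End Calculus.

(** * A smooth step function *)

Section SmoothStep.
Context {R : realType}.
Implicit Types (f g : R -> R) (n : nat) (x : R).

(* The flat functions [x^-n exp(-1/x)] (extended by 0 to [x <= 0]) span a space closed under derivation. *)
Definition flat n x : R := if 0 < x then x ^- n * expR (- x^-1) else 0.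

Lemma flat_le0 n x : x <= 0 -> flat n x = 0.
Proof. by rewrite /flat ltNge => ->. Qed.

Lemma flat_gt0 n x : 0 < x -> 0 < flat n x.
Proof. by move=> x0; rewrite /flat x0 mulr_gt0 ?expR_gt0// invr_gt0 exprn_gt0. Qed.

Lemma flat_ge0 n x : 0 <= flat n x.
Proof. by have [/flat_le0 ->//|/(flat_gt0 n)/ltW] := leP x 0. Qed.

(** At 0 this exhibits [flat n.+1] as the difference quotient of [flat n], as required by the
    criterion of Caratheodory. *)
Lemma flat_shift n x : flat n x = flat n.+1 x * x.
Proof.
rewrite /flat; case: ifP => [x0|_]; last by rewrite mul0r.
by rewrite exprS; field; rewrite expf_neq0 gt_eqF.
Qed.

(** With [y = 1 / x], the bound [exp y >= y^(n+2) / (n+2)!] makes every [flat n] a [O(x^2)], which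
    is all that continuity at 0 needs. *)
Lemma flat_le n x : flat n x <= n.+2`!%:R * x ^+ 2.
Proof.
rewrite /flat; case: ifP => [x0|_]; last by rewrite mulr_ge0 ?sqr_ge0.
have y0 : 0 < x^-1 by rewrite invr_gt0.
have := @expR_ge1Dxn R (x^-1) n.+1 (ltW y0).
rewrite expRN; set E := expR _ => H; have E0 : 0 < E := expR_gt0 _.
have F0 : 0 < n.+2`!%:R :> R by rewrite ltr0n fact_gt0.
have {H} : (x ^+ n * x ^+ 2)^-1 / n.+2`!%:R <= E.
  by apply: le_trans H; rewrite -exprD addn2 exprVn lerDr.
rewrite ler_pdivrMr// -[leLHS]mul1r ler_pdivrMr ?mulr_gt0 ?exprn_gt0// => H.
rewrite ler_pdivrMr// -[leLHS]mul1r ler_pdivrMr ?exprn_gt0//; apply: le_trans H _.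
by rewrite le_eqVlt; apply/orP; left; apply/eqP; ring.
Qed.

Lemma continuous0_flat n : {for 0, continuous (flat n)}.
Proof.
rewrite /prop_for /continuous_at flat_le0//.
have H : (n.+2`!%:R * x ^+ 2 : R) @[x --> (0 : R)] --> (0 : R).
  rewrite -[X in _ --> X](mulr0 n.+2`!%:R); apply: cvgM; first exact: cvg_cst.
  rewrite -[X in _ --> X](mulr0 0).
  by apply: cvgM; exact: cvg_id.
apply: squeeze_cvgr (cvg_cst (0 : R)) H.
by near=> x; rewrite flat_ge0 flat_le.
Unshelve. all: by end_near. Qed.

Lemma is_derive_flat n x : is_derive x 1 (flat n) (flat n.+2 x - n%:R * flat n.+1 x).
Proof.
have [x0|x0|->] := ltgtP x 0.
- have H : is_derive x 1 (fun=> 0 : R) (0 : R) by exact: is_derive_cst.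
  rewrite !flat_le0 ?(ltW x0)// mulr0 subr0.
  apply: near_eq_is_derive H; near=> y.
  by rewrite flat_le0// ltW//; near: y; exact: lt_nbhsl.
- have dc (c : R) : is_derive x 1 (fun=> c) 0 by exact: is_derive_cst.
  have dV : is_derive x 1 (fun y => y^-1) (- x ^- 2).
    have := is_deriveV (lt0r_neq0 x0) (is_derive_id x (1 : R)).
    by congr (is_derive _ _ _ _); rewrite /GRing.scale/= mulr1.
  have dE : is_derive x 1 (fun y => expR (- y^-1)) (x ^- 2 * expR (- x^-1)).
    have H : is_derive x 1 (fun y => - y^-1) (x ^- 2).
      by have := is_derive_mul (dc (- 1)) dV; congr (is_derive _ _ _ _);
        [apply/funext => y; rewrite mulN1r|ring].
    have := @is_derive1_comp R expR (fun y => - y^-1) x _ _ (is_derive_expR _) H.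
    by congr (is_derive _ _ _ _); rewrite mulrC.
  have dP : is_derive x 1 (fun y => y ^- n) (- n%:R * x ^- n.+1).
    elim: n => [|n IHn].
      rewrite oppr0 mul0r.
      by have -> : (fun y : R => y ^- 0) = (fun=> 1) by apply/funext => y; rewrite expr0 invr1.
    have := is_derive_mul dV IHn; congr (is_derive _ _ _ _).
      by apply/funext => y; rewrite exprS invfM.
    by rewrite !exprS -natr1; field; rewrite expf_neq0 gt_eqF.
  have H := is_derive_mul dP dE.
  apply: (@near_eq_is_derive _ _ _ _ (flat n)) (is_derive_eq H _).
    by near=> y; rewrite /flat ifT//; near: y; exact: lt_nbhsr.
  by rewrite /flat x0 !exprS; field; rewrite expf_neq0 gt_eqF.
- rewrite !flat_le0// mulr0 subr0; apply/is_derive1_caratheodory.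
  exists (flat n.+1); split => //; last by rewrite flat_le0.
  - by move=> z; rewrite (@flat_le0 n 0)// !subr0 -flat_shift.
  - exact: continuous0_flat.
Unshelve. all: by end_near. Qed.

(** A syntactic class that is closed under derivation: iterated derivability follows by induction,
    with no formula for the higher derivatives. *)
Inductive smooth : (R -> R) -> Prop :=
| smooth_flat n : smooth (flat n)
| smooth_cst c : smooth (fun=> c)
| smoothD f g : smooth f -> smooth g -> smooth (fun x => f x + g x)
| smoothM f g : smooth f -> smooth g -> smooth (fun x => f x * g x)
| smooth_affine a b f : smooth f -> smooth (fun x => f (a * x + b))
| smoothV f : (forall x, f x != 0) -> smooth f -> smooth (fun x => (f x)^-1).

Lemma smooth_derive f : smooth f ->
  exists2 g, smooth g & forall x : R, is_derive x 1 f (g x).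
Proof.
elim=> {f} [n|c|f g _ [f' sf' df] _ [g' sg' dg]|f g sf [f' sf' df] sg [g' sg' dg]|
            a b f _ [f' sf' df]|f f0 sf [f' sf' df]].
- exists (fun x => flat n.+2 x + (- n%:R) * flat n.+1 x).
    apply: smoothD; first exact: smooth_flat.
    by apply: smoothM; [exact: smooth_cst|exact: smooth_flat].
  by move=> x; rewrite mulNr; exact: is_derive_flat.
- by exists (fun=> 0); [exact: smooth_cst|move=> x; exact: is_derive_cst].
- exists (fun x => f' x + g' x); first exact: smoothD.
  by move=> x; exact: is_derive_add.
- exists (fun x => f' x * g x + f x * g' x).
    by apply: smoothD; apply: smoothM.
  by move=> x; exact: is_derive_mul.
- exists (fun x => a * f' (a * x + b)).
    by apply: smoothM; [exact: smooth_cst|exact: smooth_affine].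
  move=> x.
  have dc (c : R) : is_derive x 1 (fun=> c) 0 by exact: is_derive_cst.
  have H := is_derive_add (is_derive_mul (dc a) (is_derive_id x (1 : R))) (dc b).
  have := @is_derive1_comp R f (fun y => a * y + b) x _ _ (df _) H.
  by congr (is_derive _ _ _ _); ring.
- exists (fun x => (- 1) * f' x * ((f x)^-1 * (f x)^-1)).
    apply: smoothM; first by apply: smoothM => //; exact: smooth_cst.
    by apply: smoothM; exact: smoothV.
  move=> x; have := is_deriveV (f0 x) (df x).
  by congr (is_derive _ _ _ _); rewrite /GRing.scale/= expr2 invfM; ring.
Qed.

Lemma smooth_derivable f : smooth f ->
  forall n x, derivable (derive1n n f) x 1.
Proof.
move=> sf n x; suff [g /smooth_derive[g' _ dg] ->] : exists2 g, smooth g & derive1n n f = g.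
  by have [] := dg x.
elim: n => [|n [g /smooth_derive[g' sg' dg] gE]]; first by exists f.
exists g' => //; rewrite derive1nS gE.
exact: is_derive_derive1.
Qed.

Lemma smooth_continuous f : smooth f -> continuous f.
Proof. by move=> /smooth_derive[g _ dg]; exact: is_derive_continuousT dg. Qed.

(** The usual quotient of flat functions; [1 - x] is written [- 1 * x + 1] to fit the constructor
    [smooth_affine]. *)
Definition step x : R := flat 0 x / (flat 0 x + flat 0 (- 1 * x + 1)).

Lemma step_den_gt0 x : 0 < flat 0 x + flat 0 (- 1 * x + 1).
Proof.
have [x0|x0] := leP x 0; last by rewrite ltr_pwDl ?flat_gt0 ?flat_ge0.
by rewrite ltr_wpDl ?flat_ge0// flat_gt0//; lra.
Qed.

Lemma smooth_step : smooth step.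
Proof.
apply: smoothM; first exact: smooth_flat.
apply: smoothV; first by move=> x; rewrite gt_eqF ?step_den_gt0.
by apply: smoothD; [|apply: smooth_affine]; exact: smooth_flat.
Qed.

Lemma step_le0 x : x <= 0 -> step x = 0.
Proof. by move=> x0; rewrite /step flat_le0// mul0r. Qed.

Lemma step_ge1 x : 1 <= x -> step x = 1.
Proof.
move=> x1; have x0 : 0 < x by lra.
rewrite /step [flat 0 (_ + _)]flat_le0; last by lra.
by rewrite addr0 divff// gt_eqF// flat_gt0.
Qed.

Lemma step_itv x : 0 <= step x <= 1.
Proof.
rewrite /step divr_ge0 ?flat_ge0 ?(ltW (step_den_gt0 x))//=.
by rewrite ler_pdivrMr ?step_den_gt0// mul1r lerDl flat_ge0.
Qed.

(** These properties, together with the total mass [step 1 - step 0 = 1], are what makes the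
    derivative of [step] usable as a mollifier. *)
Lemma step_derivative : exists (s : R -> R) (M : R),
  [/\ continuous s, forall x : R, is_derive x 1 step (s x), 0 <= M,
      forall x, `|s x| <= M & forall x, ~~ (0 <= x <= 1) -> s x = 0].
Proof.
have [s ss ds] := smooth_derive smooth_step.
have cs := smooth_continuous ss.
have s0 x : ~~ (0 <= x <= 1) -> s x = 0.
  rewrite negb_and -!ltNge => /orP[x0|x1].
  - have H : is_derive x 1 step 0.
      have : is_derive x 1 (fun=> 0 : R) (0 : R) by exact: is_derive_cst.
      apply: near_eq_is_derive; near=> y.
      by rewrite step_le0// ltW//; near: y; exact: lt_nbhsl.
    by rewrite -(@derive_val _ _ _ _ _ _ _ (ds x)) (@derive_val _ _ _ _ _ _ _ H).
  - have H : is_derive x 1 step 0.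
      have : is_derive x 1 (fun=> 1 : R) (0 : R) by exact: is_derive_cst.
      apply: near_eq_is_derive; near=> y.
      by rewrite step_ge1// ltW//; near: y; exact: lt_nbhsr.
    by rewrite -(@derive_val _ _ _ _ _ _ _ (ds x)) (@derive_val _ _ _ _ _ _ _ H).
have [c _ cM] := @EVT_max R (fun x => `|s x|) 0 1 ler01
  (continuous_subspaceT (fun x => cvg_norm (cs x))).
exists s, `|s c|; split => // x.
by have [|/s0 ->] := boolP (0 <= x <= 1); [move=> x01; apply: cM; rewrite in_itv|rewrite normr0].
Unshelve. all: by end_near. Qed.

End SmoothStep.

(** * The lemma of du Bois-Reymond *)

Section DuBoisReymond.
Context {R : realType}.
Notation mu := (@lebesgue_measure R).
Implicit Types (u du g : R -> R) (a b c d x : R).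

Lemma Rintegral_supp g c d : (forall x, ~~ (c <= x <= d) -> g x = 0) ->
  Rintegral mu setT g = Rintegral mu `[c, d] g.
Proof.
move=> g0; rewrite [RHS]Rintegral_mkcond; congr Rintegral; apply/funext => x.
rewrite patchE; case: ifPn => //; rewrite notin_setE/= in_itv/= => /negP.
exact: g0.
Qed.

Lemma norm_le_itv a b x : a <= x <= b -> `|x| <= `|a| + `|b|.
Proof.
move=> /andP[ax xb]; have := ler_norm (- a); rewrite normrN => na.
have nb := ler_norm b; have a0 := normr_ge0 a; have b0 := normr_ge0 b.
by rewrite ler_norml; apply/andP; split; lra.
Qed.

Lemma locally_integrable_itv u c d : locally_integrable [set: R] u ->
  mu.-integrable `[c, d] (EFin \o u).
Proof.
move=> [mu_ _ /(_ _ (@subsetT _ _) (@segment_compact R c d)) H].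
apply/integrableP; split; last exact: H.
by apply/measurable_EFinP; exact: measurable_funTS mu_.
Qed.

Lemma continuous_locally_integrable u : continuous u -> locally_integrable [set: R] u.
Proof.
move=> cu; split=> //; first exact: continuous_measurable_fun.
  exact: openT.
move=> K _ cK.
have : mu.-integrable K (EFin \o u).
  by apply: continuous_compact_integrable => //; exact: continuous_subspaceT.
by case/integrableP.
Qed.

Lemma integrable_mul_supp u g c d (M : R) : locally_integrable [set: R] u ->
  measurable_fun [set: R] g -> (forall x, `|g x| <= M) ->
  (forall x, ~~ (c <= x <= d) -> g x = 0) ->
  mu.-integrable [set: R] (fun x => (u x * g x)%:E).
Proof.
move=> lu mg gM g0.
have iu : mu.-integrable [set: R] (fun x => (M%:E * ((EFin \o u) \_ `[c, d]) x)%E).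
  apply: integrableZl => //.
  apply: (integrable_mkcond _ _).1; [exact: measurable_itv|exact: locally_integrable_itv].
apply: le_integrable iu => //.
  by apply/measurable_EFinP; apply: measurable_funM => //; case: lu.
move=> x _; rewrite patchE; case: ifPn => [_|].
  by rewrite -EFinM !abse_EFin lee_fin !normrM mulrC ler_wpM2r// (le_trans (gM x))// ler_norm.
rewrite notin_setE/= in_itv/= => /negP/g0 ->.
by rewrite /= !mulr0.
Qed.

(** * One-sided mollifiers and smooth approximations of the indicator of an interval *)

Section mollifier.
Variables (s : R -> R) (M : R).
Hypotheses (cs : continuous s) (ds : forall x : R, is_derive x 1 step (s x)).
Hypotheses (M0 : 0 <= M) (sM : forall x, `|s x| <= M).
Hypothesis (s0 : forall x, ~~ (0 <= x <= 1) -> s x = 0).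

Definition bump_d (a : R) (n : nat) (x : R) : R := n.+1%:R * s (n.+1%:R * x + (- (n.+1%:R * a))).

Let N0 n : 0 < n.+1%:R :> R. Proof. by rewrite ltr0n. Qed.

Lemma continuous_bump_d a n : continuous (bump_d a n).
Proof.
apply: continuousMR; first by move=> x; exact: cvg_cst.
have ca : continuous (fun x : R => n.+1%:R * x + (- (n.+1%:R * a))).
  apply: continuousDR; last by move=> x; exact: cvg_cst.
  by apply: continuousMR => x; [exact: cvg_cst|exact: cvg_id].
by move=> x; apply: (@continuous_comp R R R _ s x (ca x)); exact: cs.
Qed.

Lemma bump_d_supp a n x : ~~ (a <= x <= a + n.+1%:R^-1) -> bump_d a n x = 0.
Proof.
move=> H; rewrite /bump_d s0 ?mulr0//; apply: contra H => /andP[h0 h1].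
apply/andP; split.
  by move: h0; rewrite subr_ge0 ler_pM2l.
by rewrite -lerBlDl -(ler_pM2l (N0 n)) mulrBr divff// gt_eqF.
Qed.

Lemma bump_d_le a n x : `|bump_d a n x| <= n.+1%:R * M.
Proof. by rewrite normrM ger0_norm ?(ltW (N0 n))// ler_pM2l. Qed.

Lemma is_derive_bump a n x :
  is_derive x 1 (fun y => step (n.+1%:R * y + (- (n.+1%:R * a)))) (bump_d a n x).
Proof.
have dc (c : R) : is_derive x 1 (fun=> c) 0 by exact: is_derive_cst.
have H := is_derive_add (is_derive_mul (dc n.+1%:R) (is_derive_id x (1 : R))) (dc (- (n.+1%:R * a))).
have := @is_derive1_comp R step (fun y => n.+1%:R * y + (- (n.+1%:R * a))) x _ _ (ds _) H.
by congr (is_derive _ _ _ _); rewrite /bump_d; ring.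
Qed.

Lemma Rintegral_bump_d a n : Rintegral mu setT (bump_d a n) = 1.
Proof.
rewrite (Rintegral_supp (@bump_d_supp a n)) /Rintegral.
rewrite (FTC_itv _ (@continuous_bump_d a n) (@is_derive_bump a n)); last first.
  by rewrite lerDl invr_ge0 ltW.
by rewrite /= mulrDr divff ?gt_eqF// addrAC subrr add0r step_ge1// step_le0 ?subr0.
Qed.

Lemma integrable_bump_d u a n : locally_integrable [set: R] u ->
  mu.-integrable [set: R] (fun x => (u x * bump_d a n x)%:E).
Proof.
move=> lu; apply: (integrable_mul_supp lu _ (@bump_d_le a n) (@bump_d_supp a n)).
exact: measurable_continuous (@continuous_bump_d a n).
Qed.

(** Since the mollifier has mass 1, the difference is the integral of [(u - u a)] against it. The
    mollifier is at most [n.+1 * M], and the ball of radius [2 / n.+1], which contains its support,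
    has measure [4 / n.+1]; whence the factor [4 * M]. Radius [1 / n.+1] would miss the right end of
    the closed support, the ball being open. *)
Lemma bump_d_dist u a n : locally_integrable [set: R] u ->
  (`|Rintegral mu setT (fun x => u x * bump_d a n x) - u a|%:E <=
    (4 * M)%:E * davg u a (2 * n.+1%:R^-1))%E.
Proof.
move=> lu; set r := 2 * n.+1%:R^-1; have r0 : 0 < r by rewrite mulr_gt0 ?invr_gt0.
have lca : locally_integrable [set: R] (fun=> u a).
  by apply: continuous_locally_integrable => x; exact: cvg_cst.
have lc : locally_integrable [set: R] (fun x => u x - u a) by exact: locally_integrableB.
have i1 : mu.-integrable [set: R] (EFin \o bump_d a n).
  apply: eq_integrable (integrable_bump_d a n (_ : locally_integrable [set: R] (fun=> 1))) => //.
    by move=> x _ /=; rewrite mul1r.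
  by apply: continuous_locally_integrable => x; exact: cvg_cst.
have -> : Rintegral mu setT (fun x => u x * bump_d a n x) - u a =
          Rintegral mu setT (fun x => (u x - u a) * bump_d a n x).
  under [RHS]eq_Rintegral do rewrite mulrBl.
  rewrite RintegralB//; [|exact: integrable_bump_d|exact: integrable_bump_d].
  by rewrite RintegralZl// Rintegral_bump_d mulr1.
have iI := integrable_bump_d a n lc.
rewrite EFin_normr_Rintegral//; apply: le_trans (le_abse_integral _ _ _) _ => //.
  by case/integrableP : iI.
have mball : measurable (ball a r) by exact: measurable_ball.
apply: (@le_trans _ _ ((n.+1%:R * M)%:E * \int[mu]_(x in ball a r) `|(u x - u a)%:E|))%E.
  rewrite -ge0_integralZl//; last 2 first.
  - by apply/measurable_EFinP/measurableT_comp => //; apply: measurable_funTS; case: lc.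
  - by rewrite lee_fin mulr_ge0 ?ler0n.
  rewrite [leRHS]integral_mkcond; apply: ge0_le_integral => //.
  - by apply: measurableT_comp => //; case/integrableP : iI.
  - apply/(measurable_restrictT _ _).1 => //; apply: measurable_funeM.
    by apply/measurable_EFinP/measurableT_comp => //; apply: measurable_funTS; case: lc.
  - move=> x _; rewrite patchE; case: ifPn => [_|].
      by rewrite !abse_EFin -EFinM lee_fin normrM mulrC ler_wpM2r// bump_d_le.
    rewrite notin_setE => xb; rewrite bump_d_supp ?mulr0 ?abse0//.
    apply/negP => /andP[ax xa]; apply: xb; rewrite /ball/= ltr_norml.
    have K (y k : R) : 0 < k -> a <= y -> y <= a + k -> - (2 * k) < a - y < 2 * k.
      by move=> *; apply/andP; split; lra.
    by apply: K ax xa; rewrite invr_gt0.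
rewrite /davg /iavg lebesgue_measure_ball ?(ltW r0)// inver gt_eqF; last by rewrite mulrn_wgt0.
rewrite muleA -EFinM lee_pmul//.
- by rewrite lee_fin mulr_ge0 ?ler0n.
- exact: integral_ge0.
by rewrite lee_fin /r le_eqVlt; apply/orP; left; apply/eqP; field; rewrite gt_eqF.
Qed.

Lemma cvg_bump_d u a : locally_integrable [set: R] u -> lebesgue_pt u a ->
  Rintegral mu setT (fun x => u x * bump_d a n x) @[n --> \oo] --> u a.
Proof.
move=> lu ua; apply/cvgrPdist_le => e e0.
(* The summand 1 keeps the denominator positive when [M = 0]. *)
have d0 : 0 < e / (4 * M + 1) by rewrite divr_gt0// ltr_wpDl// mulr_ge0.
have [r /= r0 Hr] : exists2 r : R, 0 < r & forall t, 0 < t -> t < r ->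
    (davg u a t <= (e / (4 * M + 1))%:E)%E.
  have : \forall t \near (0 : R)^'+, (davg u a t < (e / (4 * M + 1))%:E)%E.
    move/fine_cvgP : ua => [fin cv]; have lt_e := cvgr_lt _ cv _ d0.
    near=> t; rewrite -(fineK (_ : davg u a t \is a fin_num)); last by near: t.
    by rewrite lte_fin; near: t; exact: lt_e.
  move=> [r /= r0 H]; exists r => // t t0 tr; apply/ltW/H => //=.
  by rewrite sub0r normrN gtr0_norm.
near=> n; rewrite distrC -lee_fin; apply: le_trans (bump_d_dist a n lu) _.
apply: le_trans (lee_wpmul2l _ (Hr _ _ _)) _.
- by rewrite lee_fin mulr_ge0.
- by rewrite mulr_gt0 ?invr_gt0.
- rewrite ltr_pdivrMr// mulrC -ltr_pdivrMr//.
  have : 2 / r <= n%:R by near: n; exact: nbhs_infty_ger.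
  by move/le_lt_trans; apply; rewrite ltr_nat.
- rewrite -EFinM lee_fin mulrA ler_pdivrMr ?ltr_wpDl ?mulr_ge0//.
  by rewrite mulrC ler_wpM2l ?(ltW e0)// lerDl.
Unshelve. all: by end_near. Qed.

(** The derivative of this test function is the difference of the mollifiers at [a] and at [b],
    while the function itself tends to the indicator of []a, b]]. *)
Definition bump (a b : R) (n : nat) (x : R) : R :=
  step (n.+1%:R * x + (- (n.+1%:R * a))) + (- 1) * step (n.+1%:R * x + (- (n.+1%:R * b))).

Lemma bump_supp a b n x : a < b -> ~~ (a <= x <= b + n.+1%:R^-1) -> bump a b n x = 0.
Proof.
move=> ab; rewrite negb_and -!ltNge /bump => /orP[xa|xb].
  rewrite !step_le0 ?mulr0 ?addr0// subr_le0 ler_pM2l// ltW//.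
  exact: lt_trans xa ab.
have Nb : 1 <= n.+1%:R * x - n.+1%:R * b.
  by rewrite -mulrBr -ler_pdivrMl// mulr1 lerBrDl ltW.
rewrite !step_ge1//; first by rewrite mulr1 subrr.
apply: le_trans Nb _; rewrite lerD2l lerN2 ler_pM2l//; exact: ltW.
Qed.

Lemma test_fun_bump a b n : a < b -> test_fun (bump a b n).
Proof.
move=> ab; split.
  apply: smooth_derivable; apply: smoothD; first exact: smooth_affine smooth_step.
  by apply: smoothM; [exact: smooth_cst|exact: smooth_affine smooth_step].
exists (`|a| + `|b + n.+1%:R^-1|) => x Mx.
apply: bump_supp => //; apply/negP => /norm_le_itv; apply/negP; rewrite -ltNge.
exact: Mx.
Qed.

Lemma bump_itv a b n x : `|bump a b n x| <= 1.
Proof.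
rewrite /bump.
have /andP[] := step_itv (n.+1%:R * x + (- (n.+1%:R * a))).
have /andP[] := step_itv (n.+1%:R * x + (- (n.+1%:R * b))).
by move=> *; rewrite ler_norml; apply/andP; split; lra.
Qed.

Lemma derive1_bump a b n : derive1 (bump a b n) = (fun x => bump_d a n x - bump_d b n x).
Proof.
apply: is_derive_derive1 => x; have dc (c : R) : is_derive x 1 (fun=> c) 0 by exact: is_derive_cst.
have := is_derive_add (is_derive_bump a n x) (is_derive_mul (dc (- 1)) (is_derive_bump b n x)).
by congr (is_derive _ _ _ _); ring.
Qed.

(** For each [x] the sequence is eventually constant. At [a] and at [b] the step centred there is 0
    for every [n], which leaves [a] out of the limit interval and keeps [b] in. *)
Lemma cvg_bump a b x : a < b -> (bump a b n x : R) @[n --> \oo] --> (\1_`]a, b] x : R).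
Proof.
move=> ab; have large (c : R) : 0 < c -> \forall n \near \oo, 1 <= n.+1%:R * c.
  move=> c0; near=> n; rewrite -ler_pdivrMr// div1r.
  have : c^-1 <= n%:R by near: n; exact: nbhs_infty_ger.
  by move/le_trans; apply; rewrite ler_nat.
rewrite indicE mem_setE in_itv/=; apply: cvg_near_cst; have [xa|ax] := leP x a.
  near=> n; rewrite /bump !step_le0 ?mulr0 ?addr0// subr_le0 ler_pM2l//.
  by rewrite (le_trans xa)// ltW.
have [xb|bx] := leP x b.
  near=> n; rewrite /bump step_ge1.
    by rewrite step_le0 ?mulr0 ?addr0// subr_le0 ler_pM2l.
  by rewrite -mulrBr; near: n; apply: large; rewrite subr_gt0.
near=> n; rewrite /bump !step_ge1 ?mulr1 ?subrr// -mulrBr.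
  by near: n; apply: large; rewrite subr_gt0.
by near: n; apply: large; rewrite subr_gt0.
Unshelve. all: by end_near. Qed.

Lemma cvg_Rintegral_bump du a b : locally_integrable [set: R] du -> a < b ->
  Rintegral mu setT (fun x => du x * bump a b n x) @[n --> \oo] -->
  Rintegral mu `]a, b] du.
Proof.
move=> ldu ab.
have mdu : measurable_fun [set: R] du by case: ldu.
have mb n : measurable_fun [set: R] (bump a b n).
  apply: measurable_continuous; apply: smooth_continuous.
  apply: smoothD; first exact: smooth_affine smooth_step.
  by apply: smoothM; [exact: smooth_cst|exact: smooth_affine smooth_step].
have mi (i : interval R) : measurable_fun [set: R] (\1_[set` i] : R -> R).
  by apply: measurable_indic; exact: measurable_itv.
(* All the bumps are supported in [[a, b + 1]] and bounded by 1, so this function dominates. *)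
pose g x := `|(du x * \1_`[a, b + 1] x)%:E|%E.
have ig : mu.-integrable [set: R] g.
  apply: integrable_abse; apply: (@integrable_mul_supp _ _ a (b + 1) 1) => // x.
    by rewrite indicE; case: (_ \in _); rewrite ?normr1 ?normr0.
  by rewrite indicE mem_setE in_itv/= => /negbTE ->.
have [] := @dominated_convergence _ _ _ mu [set: R] measurableT
  (fun n x => (du x * bump a b n x)%:E) (fun x => (du x * \1_`]a, b] x)%:E) g _ _ _ ig _.
- by move=> n; apply/measurable_EFinP; apply: measurable_funM => //; exact: mb.
- by apply/measurable_EFinP; apply: measurable_funM => //; exact: mi.
- apply/aeW => x _; apply: cvg_EFin; first by near=> n.
  by apply: cvgM; [exact: cvg_cst|exact: cvg_bump].
- apply/aeW => x n _; rewrite /g !abse_EFin lee_fin !normrM ler_wpM2l//.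
  rewrite indicE mem_setE in_itv/=; have [xab|xab] := boolP (a <= x <= b + 1).
    by rewrite normr1 bump_itv.
  rewrite bump_supp ?normr0//; apply: contra xab => /andP[-> /le_trans]; apply.
  by rewrite lerD2l invf_le1// ler1n.
move=> iF _ H.
have -> : Rintegral mu `]a, b] du = Rintegral mu setT (fun x => du x * \1_`]a, b] x).
  by rewrite Rintegral_mkcond; congr Rintegral; rewrite patch_indic.
by apply: fine_cvg; rewrite fineK//; exact: integrable_fin_num iF.
Unshelve. all: by end_near. Qed.

End mollifier.

(** Test the weak derivative against [bump a b n]: one side tends to [u a - u b] by Lebesgue
    differentiation, the other to minus the integral of [du] by dominated convergence. *)
Lemma du_bois_reymond u du a b : weak_derivative u du -> a < b ->
  lebesgue_pt u a -> lebesgue_pt u b -> u b - u a = Rintegral mu `]a, b] du.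
Proof.
move=> [lu [ldu wd]] ab ua ub.
have [s [M [cs ds M0 sM s0]]] := @step_derivative R.
have H1 : Rintegral mu setT (fun x => u x * derive1 (bump a b n) x) @[n --> \oo] --> u a - u b.
  have -> : (fun n => Rintegral mu setT (fun x => u x * derive1 (bump a b n) x)) =
    (fun n => Rintegral mu setT (fun x => u x * bump_d s a n x) -
              Rintegral mu setT (fun x => u x * bump_d s b n x)).
    apply/funext => n; rewrite (derive1_bump ds).
    under eq_Rintegral do rewrite mulrBr.
    by rewrite RintegralB//; exact: (integrable_bump_d cs sM s0).
  by apply: cvgB; exact: (cvg_bump_d cs ds M0 sM s0).
have H2 : Rintegral mu setT (fun x => u x * derive1 (bump a b n) x) @[n --> \oo] -->
    - Rintegral mu `]a, b] du.
  have -> : (fun n => Rintegral mu setT (fun x => u x * derive1 (bump a b n) x)) =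
    (fun n => - Rintegral mu setT (fun x => du x * bump a b n x)).
    by apply/funext => n; rewrite wd//; exact: test_fun_bump.
  by apply: cvgN; exact: cvg_Rintegral_bump.
have E : u a - u b = - Rintegral mu `]a, b] du := cvg_unique (@Rhausdorff R) H1 H2.
by apply: oppr_inj; rewrite -E opprB.
Qed.

End DuBoisReymond.

(** * A weighted Hardy inequality *)

Section WeightedHardy.
Context {R : realType}.
Notation mu := (@lebesgue_measure R).
Implicit Types (u du W F p : R -> R) (a b c t x : R).

(** The point [t] lies between 0 and [x], on either half-line. Read in [t] this is an interval
    ending at 0, read in [x] a ray starting at [t]: the two orders of integration in the Tonelli
    argument. Excluding [t = 0] makes the ray unambiguous. *)
Definition between t x : bool := (0 < t <= x) || (x <= t < 0).

Definition ind t x : R := (between t x)%:R.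

Lemma ind_ge0 t x : 0 <= ind t x.
Proof. exact: ler0n. Qed.

Lemma between_gt0 t x : 0 <= x -> between t x = (t \in `]0, x]).
Proof.
move=> x0; rewrite /between in_itv/= [X in _ || X](_ : _ = false) ?orbF//.
by apply/negP => /andP[/(le_trans x0)/le_lt_trans H /H]; rewrite ltxx.
Qed.

Lemma between_lt0 t x : x <= 0 -> between t x = (t \in `[x, 0[).
Proof.
move=> x0; rewrite /between in_itv/= [X in X || _](_ : _ = false)//.
by apply/negP => /andP[t0 /le_trans/(_ x0)]; rewrite leNgt t0.
Qed.

Lemma between_t_gt0 t x : 0 < t -> between t x = (x \in `[t, +oo[).
Proof. by move=> t0; rewrite /between in_itv/= t0 [t < 0]ltNge (ltW t0) andbF orbF andbT. Qed.

Lemma between_t_lt0 t x : t < 0 -> between t x = (x \in `]-oo, t]).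
Proof. by move=> t0; rewrite /between in_itv/= t0 [0 < t]ltNge (ltW t0) andbT. Qed.

Lemma between0 x : between 0 x = false.
Proof. by rewrite /between ltxx andbF. Qed.

Lemma integral_itv_ind (g : R -> R) (b : R -> bool) (i : interval R) :
  (forall t, b t = (t \in i)) ->
  (\int[mu]_t (g t * (b t)%:R)%:E = \int[mu]_(t in [set` i]) (g t)%:E)%E.
Proof.
move=> bi; rewrite [RHS]integral_mkcond; apply: eq_integral => t _.
by rewrite patchE mem_setE bi; case: (_ \in _); rewrite ?mulr1 ?mulr0.
Qed.

Lemma measurable_ind : measurable_fun [set: R * R] (fun z => ind z.2 z.1).
Proof.
have mb : measurable_fun [set: R * R] (fun z => between z.2 z.1).
  apply: measurable_or; apply: measurable_and;
    by [apply: measurable_fun_ltr|apply: measurable_fun_ler].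
have -> : (fun z : R * R => ind z.2 z.1) = (fun z => if between z.2 z.1 then 1 else 0).
  by apply/funext => z; rewrite /ind; case: between.
exact: measurable_fun_ifT.
Qed.

Lemma Rintegral_itv_split du a x b : locally_integrable [set: R] du -> a <= x -> x <= b ->
  Rintegral mu `]a, b] du = Rintegral mu `]a, x] du + Rintegral mu `]x, b] du.
Proof.
move=> ldu ax xb.
have i : mu.-integrable `]a, b] (EFin \o du).
  apply: integrableS (locally_integrable_itv a b ldu) => //.
  exact: subset_itv_oc_cc.
have := @Rintegral_itvB R du (BRight a) (BRight b) x i.
by rewrite !bnd_simp => /(_ ax xb) <-; rewrite addrC subrK.
Qed.

Lemma Rintegral_itv_empty du a b : b <= a -> Rintegral mu `]a, b] du = 0.
Proof. by move=> ba; rewrite set_itv_ge ?Rintegral_set0// bnd_simp -leNgt. Qed.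

Lemma Rintegral_itv_bound du x : locally_integrable [set: R] du ->
  (`|Rintegral mu `]0, x] du - Rintegral mu `]x, 0] du|%:E <=
   \int[mu]_t (`|du t| * ind t x)%:E)%E.
Proof.
move=> ldu.
have H a b : (`|Rintegral mu `]a, b] du|%:E <= \int[mu]_(t in `]a, b]) `|du t|%:E)%E.
  have i : mu.-integrable `]a, b] (EFin \o du).
    apply: integrableS (locally_integrable_itv a b ldu) => //.
    exact: subset_itv_oc_cc.
  by rewrite EFin_normr_Rintegral//; apply: le_abse_integral => //; case/integrableP: i.
have [x0|x0] := leP 0 x.
  rewrite (Rintegral_itv_empty _ x0) subr0 (le_trans (H _ _))//.
  by rewrite (@integral_itv_ind (fun t => `|du t|) _ `]0, x])// => t; rewrite between_gt0.
rewrite (Rintegral_itv_empty _ (ltW x0)) sub0r normrN (le_trans (H _ _))//.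
rewrite (@integral_itv_ind (fun t => `|du t|) _ `[x, 0[); last by move=> t; rewrite between_lt0// ltW.
have mdu : measurable_fun [set: R] (fun t => `|du t|%:E).
  by apply/measurable_EFinP/measurableT_comp => //; case: ldu.
rewrite integral_itv_bndo_bndc; last exact: measurable_funTS mdu.
by rewrite integral_itv_obnd_cbnd//; exact: measurable_funTS mdu.
Qed.

(** The constant [c] stands for [u 0], which is meaningless if 0 is not a Lebesgue point. It is read
    off at some Lebesgue point [a0] instead, as [u a0] minus the primitive of [du] there. *)
Lemma weak_derivative_bound u du : weak_derivative u du ->
  exists c, \forall x \ae mu, (`|u x - c|%:E <= \int[mu]_t (`|du t| * ind t x)%:E)%E.
Proof.
move=> wd; have [lu [ldu _]] := wd.
(* The primitive of [du] vanishing at 0; for each [x] at least one of the two intervals is empty. *)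
pose v x := Rintegral mu `]0, x] du - Rintegral mu `]x, 0] du.
have vB a b : a < b -> v b - v a = Rintegral mu `]a, b] du.
  move=> ab; rewrite /v; have [a0|a0] := leP 0 a.
    rewrite (Rintegral_itv_empty _ a0) (Rintegral_itv_empty _ (le_trans a0 (ltW ab))).
    by rewrite (Rintegral_itv_split ldu a0 (ltW ab)); ring.
  have [b0|b0] := leP b 0.
    rewrite (Rintegral_itv_empty _ b0) (Rintegral_itv_empty _ (ltW a0)).
    by rewrite (Rintegral_itv_split ldu (ltW ab) b0); ring.
  rewrite (Rintegral_itv_empty _ (ltW b0)) (Rintegral_itv_empty _ (ltW a0)).
  by rewrite (Rintegral_itv_split ldu (ltW a0) (ltW b0)); ring.
have L := lebesgue_differentiation lu.
(* Otherwise the whole line would be negligible. *)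
have [a0 La0] : exists a0, lebesgue_pt u a0.
  apply/not_existsP => nL.
  case: L => A [mA A0 LA].
  have : A = [set: R] by apply/seteqP; split => // x _; apply: LA; exact: nL.
  by move=> AT; move: A0; rewrite AT -set_itvNyy lebesgue_measure_itv.
exists (u a0 - v a0).
suff key x : lebesgue_pt u x ->
    (`|u x - (u a0 - v a0)|%:E <= \int[mu]_t (`|du t| * ind t x)%:E)%E.
  by apply: filterS key L; exact: (ae_filter_ringOfSetsType mu).
move=> Lx; suff -> : u x - (u a0 - v a0) = v x by exact: Rintegral_itv_bound.
have [xa|ax|->] := ltgtP x a0; last by ring.
  by have := du_bois_reymond wd xa Lx La0; rewrite -vB// => /eqP; rewrite subr_eq => /eqP ->; ring.
by have := du_bois_reymond wd ax La0 Lx; rewrite -vB// => /eqP; rewrite subr_eq => /eqP ->; ring.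
Qed.

Lemma continuousVR W : continuous W -> (forall t, 0 < W t) -> continuous (fun t => (W t)^-1).
Proof. by move=> cW W0 t; apply: cvgV; [rewrite gt_eqF|exact: cW]. Qed.

(* The choice [s = |y| / B] in [2 |du| <= du^2 / (s W) + s W] gives Cauchy-Schwarz without square roots. *)
Lemma weighted_cauchy_schwarz du W p (B y : R) :
  measurable_fun [set: R] du -> continuous W -> (forall t, 0 < W t) ->
  measurable_fun [set: R] p -> (forall t, 0 <= p t) ->
  0 < B -> (\int[mu]_t (W t * p t)%:E = B%:E)%E ->
  (`|y|%:E <= \int[mu]_t (`|du t| * p t)%:E)%E ->
  ((y ^+ 2)%:E <= (\int[mu]_t (du t ^+ 2 / W t * p t)%:E) * B%:E)%E.
Proof.
move=> mdu cW W0 mp p0 B0 WB yI.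
have mW : measurable_fun [set: R] W by exact: continuous_measurable_fun.
have mA : measurable_fun [set: R] (fun t => du t ^+ 2 / W t * p t).
  apply: measurable_funM => //; apply: measurable_funM; first exact: measurable_funX.
  exact: continuous_measurable_fun (continuousVR cW W0).
have A0 t : 0 <= du t ^+ 2 / W t * p t by rewrite mulr_ge0// divr_ge0 ?sqr_ge0// ltW.
have mWp : measurable_fun [set: R] (fun t => W t * p t) by exact: measurable_funM.
have Wp0 t : 0 <= W t * p t by rewrite mulr_ge0// ltW.
have [->|y0] := eqVneq y 0.
  rewrite expr0n mule_ge0 ?lee_fin ?(ltW B0)//.
  by apply: integral_ge0 => t _; rewrite lee_fin.
have ny0 : 0 < `|y| by rewrite normr_gt0.
pose s := `|y| / B; have s0 : 0 < s by rewrite divr_gt0.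
have : (`|y|%:E <= ((2 * s)^-1)%:E * (\int[mu]_t (du t ^+ 2 / W t * p t)%:E) +
   (s / 2)%:E * B%:E)%E.
  apply: le_trans yI _; rewrite -WB.
  rewrite -ge0_integralZl//; last 3 first.
  - exact/measurable_EFinP.
  - by move=> t _; rewrite lee_fin.
  - by rewrite lee_fin invr_ge0 mulr_ge0// ltW.
  rewrite -ge0_integralZl//; last 3 first.
  - exact/measurable_EFinP.
  - by move=> t _; rewrite lee_fin.
  - by rewrite lee_fin divr_ge0// ltW.
  rewrite -ge0_integralD//; last 4 first.
  - by move=> t _; rewrite -EFinM lee_fin mulr_ge0// invr_ge0 mulr_ge0// ltW.
  - by apply: measurable_funeM; exact/measurable_EFinP.
  - by move=> t _; rewrite -EFinM lee_fin mulr_ge0// divr_ge0// ltW.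
  - by apply: measurable_funeM; exact/measurable_EFinP.
  apply: ge0_le_integral => //.
  - by move=> t _; rewrite lee_fin mulr_ge0.
  - by apply/measurable_EFinP; apply: measurable_funM => //; exact: measurableT_comp.
  - by apply: emeasurable_funD; apply: measurable_funeM; exact/measurable_EFinP.
  move=> t _; rewrite -!EFinM -EFinD lee_fin.
  have -> : (2 * s)^-1 * (du t ^+ 2 / W t * p t) + s / 2 * (W t * p t) =
      (`|du t| ^+ 2 / (2 * s * W t) + s / 2 * W t) * p t.
    by rewrite real_normK ?num_real//; field; rewrite !gt_eqF.
  rewrite ler_wpM2r// -subr_ge0.
  have -> : `|du t| ^+ 2 / (2 * s * W t) + s / 2 * W t - `|du t| =
      (`|du t| - s * W t) ^+ 2 / (2 * s * W t).
    by field; rewrite !gt_eqF.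
  apply: divr_ge0; first exact: sqr_ge0.
  by apply/ltW/mulr_gt0 => //; exact: mulr_gt0.
have : (0 <= \int[mu]_t (du t ^+ 2 / W t * p t)%:E)%E.
  by apply: integral_ge0 => t _; rewrite lee_fin.
case: (\int[mu]_t (du t ^+ 2 / W t * p t)%:E)%E => [A _||//].
- rewrite -!EFinM -EFinD !lee_fin /s -(real_normK (num_real y)) => H.
  have -> : A * B = 2 * `|y| * ((2 * (`|y| / B))^-1 * A + `|y| / B / 2 * B) - `|y| ^+ 2.
    by field; rewrite !gt_eqF.
  have y2 : 0 <= 2 * `|y| by rewrite mulr_ge0.
  have := ler_wpM2l y2 H.
  by rewrite -subr_ge0 => H'; rewrite -subr_ge0; move: H'; congr (0 <= _); ring.
- by move=> _ _; rewrite gt0_mulye ?lte_fin// leey.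
Qed.

(** Cauchy-Schwarz with weight [W] bounds [(u - c)^2] by [F x] times the integral of [du^2 / W]
    between 0 and [x]. After Tonelli, the inner integral in [x] is controlled by [FC], whose factor
    [W t] cancels the weight. All integrals are nonnegative extended reals, so no integrability is
    asked of [u] or [du]. *)
Lemma weighted_hardy W F (C : R) u du : continuous W -> (forall t, 0 < W t) ->
  measurable_fun [set: R] F -> (forall x, x != 0 -> 0 < F x) -> 0 <= F 0 -> 0 <= C ->
  (forall x, x != 0 -> (\int[mu]_t (W t * ind t x)%:E = (F x)%:E)%E) ->
  (forall t, t != 0 ->
    (\int[mu]_x (F x * dens x * ind t x)%:E <= (C * (W t * dens t))%:E)%E) ->
  weak_derivative u du ->
  exists c, (\int[mu]_x ((u x - c) ^+ 2 * dens x)%:E <=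
             C%:E * \int[mu]_t (du t ^+ 2 * dens t)%:E)%E.
Proof.
move=> cW W0 mF F0 F00 C0 FE FC wd; have [lu [ldu _]] := wd.
have [c uc] := weak_derivative_bound wd; exists c.
have mW : measurable_fun [set: R] W by exact: continuous_measurable_fun.
have mdu : measurable_fun [set: R] du by case: ldu.
have mu_ : measurable_fun [set: R] u by case: lu.
have md : measurable_fun [set: R] (@dens R) by exact: continuous_measurable_fun continuous_dens.
have Fge0 x : 0 <= F x by have [->//|/F0/ltW] := eqVneq x 0.
have dW0 t : 0 <= du t ^+ 2 / W t := divr_ge0 (sqr_ge0 _) (ltW (W0 t)).
have Fd0 x : 0 <= F x * dens x := mulr_ge0 (Fge0 x) (dens_ge0 x).
have mind1 x : measurable_fun [set: R] (fun t => ind t x).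
  exact: (measurableT_comp measurable_ind (measurable_pair1 x)).
have mind2 t : measurable_fun [set: R] (fun x => ind t x).
  exact: (measurableT_comp measurable_ind (measurable_pair2 t)).
have mdW : measurable_fun [set: R] (fun t => du t ^+ 2 / W t).
  by apply: measurable_funM; [exact: measurable_funX|exact: continuous_measurable_fun (continuousVR cW W0)].
pose k (z : R * R) : \bar R := (du z.2 ^+ 2 / W z.2 * ind z.2 z.1 * (F z.1 * dens z.1))%:E.
have mk : measurable_fun [set: R * R] k.
  apply/measurable_EFinP; apply: measurable_funM; first apply: measurable_funM.
  - exact: (measurableT_comp mdW measurable_snd).
  - exact: measurable_ind.
  - by apply: measurable_funM; apply: (measurableT_comp _ measurable_fst).
have k0 z : (0 <= k z)%E.
  by rewrite lee_fin; apply: mulr_ge0; [apply: mulr_ge0; [exact: dW0|exact: ind_ge0]|exact: Fd0].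
apply: (@le_trans _ _ (\int[mu]_x \int[mu]_t k (x, t))%E).
  apply: ae_ge0_le_integral => //.
  - by move=> x _; rewrite lee_fin mulr_ge0 ?sqr_ge0 ?dens_ge0.
  - apply/measurable_EFinP; apply: measurable_funM => //; apply: measurable_funX.
    exact: measurable_funB.
  - by move=> x _; exact: integral_ge0.
  - exact: measurable_fun_fubini_tonelli_F.
  (* At 0 the integral of the weight vanishes, whereas [weighted_cauchy_schwarz] asks for a positive
     one. *)
  have n0 : \forall x \ae mu, x != 0.
    exists [set 0]; split => //; first exact: lebesgue_measure_set1.
    by move=> x /= /negP; rewrite negbK => /eqP.
  have key x : (`|u x - c|%:E <= \int[mu]_t (`|du t| * ind t x)%:E)%E -> x != 0 ->
      (((u x - c) ^+ 2 * dens x)%:E <= \int[mu]_t k (x, t))%E.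
    move=> ux x0; have := weighted_cauchy_schwarz mdu cW W0 (mind1 x) (fun t => ind_ge0 t x)
      (F0 _ x0) (FE _ x0) ux.
    have d0 : (0 <= (dens x)%:E)%E by rewrite lee_fin dens_ge0.
    move=> /(lee_wpmul2r d0); rewrite -EFinM => /le_trans; apply.
    rewrite -muleA -EFinM muleC -ge0_integralZl//.
    - by rewrite le_eqVlt; apply/orP; left; apply/eqP; apply: eq_integral => t _; rewrite -EFinM mulrC.
    - by apply/measurable_EFinP; exact: (measurable_funM mdW (mind1 x)).
    - by move=> t _; rewrite lee_fin; apply: mulr_ge0; [exact: dW0|exact: ind_ge0].
    - by rewrite lee_fin Fd0.
  have FF := ae_filter_ringOfSetsType mu.
  by apply: filterS2 uc n0 => x /= h1 h2 _; exact: key.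
have -> : (\int[mu]_x \int[mu]_t k (x, t) = \int[mu]_t \int[mu]_x k (x, t))%E.
  exact: (@fubini_tonelli _ _ _ _ R mu mu k).
rewrite -ge0_integralZl//; last 2 first.
- by apply/measurable_EFinP; apply: measurable_funM => //; exact: measurable_funX.
- by move=> t _; rewrite lee_fin mulr_ge0 ?sqr_ge0 ?dens_ge0.
apply: ge0_le_integral => //.
- by move=> t _; exact: integral_ge0.
- exact: measurable_fun_fubini_tonelli_G.
- by apply: measurable_funeM; apply/measurable_EFinP; apply: measurable_funM => //; exact: measurable_funX.
move=> t _.
have -> : (\int[mu]_x k (x, t) = (du t ^+ 2 / W t)%:E * \int[mu]_x (F x * dens x * ind t x)%:E)%E.
  rewrite -ge0_integralZl//.
  - by apply: eq_integral => x _; rewrite -EFinM /k/=; congr EFin; ring.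
  - by apply/measurable_EFinP; exact: (measurable_funM (measurable_funM mF md) (mind2 t)).
  - by move=> x _; rewrite lee_fin; apply: mulr_ge0; [exact: Fd0|exact: ind_ge0].
  - by rewrite lee_fin dW0.
have [->|t0] := eqVneq t 0.
  rewrite integral0_eq ?mule0; last by move=> x _; rewrite /ind between0 mulr0.
  by rewrite -EFinM lee_fin; apply: mulr_ge0 => //; apply: mulr_ge0; [exact: sqr_ge0|exact: dens_ge0].
apply: le_trans (lee_wpmul2l _ (FC _ t0)) _.
  by rewrite lee_fin dW0.
by rewrite -!EFinM lee_fin le_eqVlt; apply/orP; left; apply/eqP; field; rewrite gt_eqF.
Qed.

End WeightedHardy.

(** * From a supersolution to the Poincare inequality *)

Section UpperBound.
Context {R : realType}.
Notation mu := (@lebesgue_measure R).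
Implicit Types (u du g : R -> R) (a b c t x : R).

Lemma ge0_integral_itv_split g a b (c : itv_bound R) : (forall x, 0 <= g x) ->
  measurable_fun [set: R] g -> a <= b -> (BRight b <= c)%O ->
  (\int[mu]_(x in [set` Interval (BLeft a) c]) (g x)%:E =
   \int[mu]_(x in `[a, b]) (g x)%:E + \int[mu]_(x in [set` Interval (BLeft b) c]) (g x)%:E)%E.
Proof.
move=> g0 mg ab bc; have mgE (D : set R) : measurable_fun D (EFin \o g).
  by apply/measurable_EFinP; exact: measurable_funTS mg.
rewrite (@itv_bndbnd_setU _ _ (BLeft a) (BRight b) c)//.
rewrite ge0_integral_setU//=.
- by congr (_ + _)%E; exact: integral_itv_obnd_cbnd.
- exact: mgE.
- by move=> x _; rewrite lee_fin.
- apply/disj_setPS => x [/=]; rewrite !in_itv/= => /andP[_ xb].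
  by case: (c) => [[] y|[]] /=; rewrite ?andbT ?andbF// ltNge xb.
Qed.

Lemma continuous_compR (g h : R -> R) : continuous g -> continuous h ->
  continuous (fun x => h (g x)).
Proof. by move=> cg ch x; exact: (@continuous_comp R R R g h x (cg x) (ch _)). Qed.

Section Comparison.
Variables (C X : R) (f w dw : R -> R).
Hypotheses (X0 : 0 < X) (X12 : 12 <= X ^+ 2) (f0 : f 0 = 0) (C1 : 1 <= C).
Hypotheses (df : forall x : R, is_derive x 1 f (w x)) (d2f : forall x : R, is_derive x 1 w (dw x)).
Hypotheses (cdw : continuous dw) (w0 : forall x, 0 <= x <= X -> 0 < w x).
Hypothesis f_gt0 : forall x, 0 < x <= X -> 0 < f x.
Hypothesis super : forall x, 0 <= x <= X -> f x <= C * (dV x * w x - dw x).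
Hypothesis superX : f X <= C * (dV X * w X).

(** Evaluating at [m x] makes the weight even and freezes it at [w X] beyond [X]. *)
Let m x : R := Num.min `|x| X.
Let W x : R := w (m x).
(* The odd primitive of [W], up to sign: [f] continued linearly beyond [X]. *)
Let F x : R := f (m x) + w X * (`|x| - m x).

Let wX : 0 < w X. Proof. by apply: w0; rewrite lexx ltW. Qed.

Let C0 : 0 <= C. Proof. exact: le_trans C1. Qed.

Let m_itv x : 0 <= m x <= X.
Proof. by rewrite /m le_min normr_ge0 (ltW X0)/= ge_min lexx orbT. Qed.

Let mN x : m (- x) = m x. Proof. by rewrite /m normrN. Qed.

Let m_small x : 0 <= x <= X -> m x = x.
Proof. by move=> /andP[x0 xX]; rewrite /m ger0_norm//; exact/min_idPl. Qed.

Let m_large x : X <= x -> m x = X.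
Proof. by move=> xX; rewrite /m ger0_norm ?(le_trans (ltW X0))//; exact/min_idPr. Qed.

Let cn : continuous (fun x : R => `|x|).
Proof. by move=> x; exact: norm_continuous. Qed.

Let cm : continuous m.
Proof. by move=> x; apply: (@continuous_min _ _ (fun x : R => `|x|) (fun=> X)); [exact: cn|exact: cst_continuous]. Qed.

Let cW : continuous W.
Proof. exact: continuous_compR cm (is_derive_continuousT d2f). Qed.

Let cF : continuous F.
Proof.
apply: continuousDR.
  exact: continuous_compR cm (is_derive_continuousT df).
apply: continuousMR; first by move=> x; exact: cvg_cst.
by apply: continuousDR => //; exact: continuousNR.
Qed.

Let W0 x : 0 < W x. Proof. exact: w0 (m_itv x). Qed.

Let mW : measurable_fun [set: R] W. Proof. exact: continuous_measurable_fun. Qed.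

Let mF : measurable_fun [set: R] F. Proof. exact: continuous_measurable_fun. Qed.

Let WN x : W (- x) = W x. Proof. by rewrite /W mN. Qed.

Let FN x : F (- x) = F x. Proof. by rewrite /F mN normrN. Qed.

Let F_small x : 0 <= x <= X -> F x = f x.
Proof. by move=> xX; rewrite /F m_small// ger0_norm ?subrr ?mulr0 ?addr0//; case/andP: xX. Qed.

Let F_large x : X <= x -> F x = f X + w X * (x - X).
Proof. by move=> xX; rewrite /F m_large// ger0_norm// (le_trans (ltW X0)). Qed.

Let F0 x : x != 0 -> 0 < F x.
Proof.
move=> x0; rewrite /F ltr_pwDl//.
  by apply: f_gt0; rewrite /m lt_min normr_gt0 x0 X0/= ge_min lexx orbT.
by rewrite mulr_ge0 ?(ltW wX)// subr_ge0 ge_min lexx.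
Qed.

Let F00 : F 0 = 0.
Proof. by rewrite F_small ?lexx ?ltW. Qed.

Let Fge0 x : 0 <= F x.
Proof. by have [->|/F0/ltW//] := eqVneq x 0; rewrite F00. Qed.

Let int_W_pos x : 0 < x -> (\int[mu]_(t in `[0%R, x]) (W t)%:E = (F x)%:E)%E.
Proof.
move=> x0; have small y : 0 <= y <= X -> (\int[mu]_(t in `[0%R, y]) (W t)%:E = (f y)%:E)%E.
  move=> /andP[y0 yX].
  transitivity (\int[mu]_(t in `[0%R, y]) (w t)%:E)%E.
    apply: eq_integral => t; rewrite mem_setE in_itv/= => /andP[t0 ty].
    by rewrite /W m_small// t0 (le_trans ty).
  by rewrite (FTC_itv y0 (is_derive_continuousT d2f) df) f0 subr0.
have [xX|Xx] := leP x X; first by rewrite small ?F_small ?(ltW x0).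
rewrite (@ge0_integral_itv_split W 0 X (BRight x))//.
- rewrite small ?lexx ?ltW// F_large ?(ltW Xx)// EFinD; congr (_ + _)%E.
  transitivity (\int[mu]_(t in `[X, x]) (w X)%:E)%E.
    apply: eq_integral => t; rewrite mem_setE in_itv/= => /andP[t0 ty].
    by rewrite /W m_large.
  rewrite integral_cst//= lebesgue_measure_itv/= lte_fin Xx -EFinD.
  by rewrite -EFinM.
- by move=> t; exact: ltW.
- exact: ltW.
- by rewrite bnd_simp ltW.
Qed.

Let int_W x : x != 0 -> (\int[mu]_t (W t * ind t x)%:E = (F x)%:E)%E.
Proof.
have mWE (D : set R) : measurable_fun D (EFin \o W).
  by apply/measurable_EFinP; exact: measurable_funTS mW.
move=> x0; have [x_lt0|x_gt0|] := ltgtP x 0; last by move/eqP: x0.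
- rewrite (@integral_itv_ind _ W (fun t => between t x) `[x, 0[); last first.
    by move=> t; rewrite between_lt0// ltW.
  rewrite integral_itv_bndo_bndc//.
  have := @integration_by_substitution_oppr R W 0 (- x).
  rewrite opprK oppr0 oppr_ge0 ltW// => -> //; last exact: continuous_subspaceT.
  have -> : W \o -%R = W by apply/funext => t; exact: WN.
  by rewrite int_W_pos ?oppr_gt0// FN.
- rewrite (@integral_itv_ind _ W (fun t => between t x) `]0, x]); last first.
    by move=> t; rewrite between_gt0// ltW.
  by rewrite integral_itv_obnd_cbnd// int_W_pos.
Qed.

Let dV_ge0 x : X <= x -> 0 <= dV x.
Proof.
move=> xX; have x0 : 0 <= x := le_trans (ltW X0) xX.
have -> : dV x = x * (x ^+ 2 - 4) by rewrite /dV; ring.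
rewrite mulr_ge0// subr_ge0 (@le_trans _ _ (X ^+ 2))//.
  by apply: le_trans X12; rewrite ler_nat.
by rewrite lerXn2r// nnegrE ltW.
Qed.

(** The cofactor of [x - X] in [dV x - dV X] is [x^2 + x X + X^2 - 4], which exceeds 1 as soon as
    [X^2 >= 12]. *)
Let dV_incr x : X <= x -> x - X <= dV x - dV X.
Proof.
move=> xX; have x0 : 0 <= x := le_trans (ltW X0) xX.
have -> : dV x - dV X = (x - X) * (x ^+ 2 + x * X + (X ^+ 2 - 4)) by rewrite /dV; ring.
rewrite -[leLHS]mulr1 ler_wpM2l ?subr_ge0//.
have := sqr_ge0 x; have : 0 <= x * X by rewrite mulr_ge0// ltW.
move: X12; move: (X ^+ 2) (x ^+ 2) (x * X) => p q r; lra.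
Qed.

(** Beyond [X] the weight is constant, so the supersolution inequality has no [w'] term. It holds at
    [X] by [superX], and it persists because [C * w X * dV] grows at least as fast as the linear
    [F], thanks to [1 <= C]. *)
Let F_tail x : X <= x -> F x <= C * w X * dV x.
Proof.
move=> xX; rewrite F_large//.
have h1 : w X * (x - X) <= w X * (dV x - dV X) by rewrite ler_wpM2l ?(ltW wX) ?dV_incr.
have h2 : w X * (dV x - dV X) <= C * (w X * (dV x - dV X)).
  by rewrite ler_peMl// mulr_ge0 ?(ltW wX)// (le_trans _ (dV_incr xX))// subr_ge0.
by apply: le_trans (lerD superX (le_trans h1 h2)) _; rewrite le_eqVlt; apply/orP; left; apply/eqP; ring.
Qed.

Let int_ray t : X <= t ->
  (\int[mu]_(x in `[t, +oo[) (C * w X * (dV x * dens x))%:E = (C * w X * dens t)%:E)%E.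
Proof.
have c0 : 0 <= C * w X by rewrite mulr_ge0// ltW.
move=> tX; have cg : continuous (fun x => C * w X * (dV x * dens x)).
  apply: continuousMR; first by move=> x; exact: cvg_cst.
  exact: continuousMR continuous_dV continuous_dens.
have dg x : is_derive x 1 (fun y => - (C * w X) * dens y) (C * w X * (dV x * dens x)).
  have dc : is_derive x 1 (fun=> - (C * w X)) 0 by exact: is_derive_cst.
  by have := is_derive_mul dc (is_derive_dens x); congr (is_derive _ _ _ _); ring.
have lg : (- (C * w X) * dens x) @[x --> +oo] --> (0 : R).
  by rewrite -[X in _ --> X](mulr0 (- (C * w X))); apply: cvgM; [exact: cvg_cst|exact: cvg_dens].
rewrite (ge0_FTC_ray _ cg dg lg); first by rewrite mulNr sub0r opprK.
move=> x tx; apply: mulr_ge0 => //; rewrite mulr_ge0 ?dens_ge0// dV_ge0//.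
exact: le_trans tx.
Qed.

Let cFd : continuous (fun x => F x * dens x).
Proof. exact: continuousMR cF continuous_dens. Qed.

Let Fd0 x : 0 <= F x * dens x. Proof. by rewrite mulr_ge0 ?dens_ge0. Qed.

Let int_Fdens_ray t : X <= t ->
  (\int[mu]_(x in `[t, +oo[) (F x * dens x)%:E <= (C * w X * dens t)%:E)%E.
Proof.
move=> tX; rewrite -int_ray//; apply: ge0_le_integral; first exact: measurable_itv.
- by move=> x _; rewrite lee_fin.
- exact: measurable_EFin_continuous cFd.
- apply: measurable_EFin_continuous; apply: continuousMR; first by move=> x; exact: cvg_cst.
  exact: continuousMR continuous_dV continuous_dens.
- move=> x /=; rewrite in_itv/= andbT => tx; rewrite lee_fin mulrA ler_wpM2r ?dens_ge0// F_tail//.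
  exact: le_trans tx.
Qed.

(** The function [- C w exp (- V)] is a primitive of [C (V' w - w') exp (- V)], which dominates
    [F exp (- V)] up to [X]. The boundary term that it leaves at [X] is exactly the bound for the
    remaining ray. *)
Let int_Fdens_pos t : 0 < t ->
  (\int[mu]_(x in `[t, +oo[) (F x * dens x)%:E <= (C * (W t * dens t))%:E)%E.
Proof.
move=> t0; have [Xt|tX] := leP X t.
  by apply: le_trans (int_Fdens_ray Xt) _; rewrite /W m_large// mulrA.
rewrite (@ge0_integral_itv_split (fun x => F x * dens x) t X)//; last 2 first.
- exact: continuous_measurable_fun cFd.
- exact: ltW.
have cg : continuous (fun x => C * (dV x * w x - dw x) * dens x).
  apply: continuousMR continuous_dens; apply: continuousMR; first by move=> x; exact: cvg_cst.
  apply: continuousDR; last exact: continuousNR.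
  exact: continuousMR continuous_dV (is_derive_continuousT d2f).
have -> : (C * (W t * dens t))%:E = ((C * (w t * dens t) - C * w X * dens X)%:E +
    (C * w X * dens X)%:E)%E.
  by rewrite -EFinD subrK /W m_small// (ltW t0) ltW.
apply: leeD; last exact: int_Fdens_ray.
have dg x : is_derive x 1 (fun y => - C * (w y * dens y)) (C * (dV x * w x - dw x) * dens x).
  have dc : is_derive x 1 (fun=> - C) 0 by exact: is_derive_cst.
  have := is_derive_mul dc (is_derive_mul (d2f x) (is_derive_dens x)).
  by congr (is_derive _ _ _ _); ring.
have -> : C * (w t * dens t) - C * w X * dens X =
    (- C * (w X * dens X)) - (- C * (w t * dens t)) by ring.
rewrite -(FTC_itv (ltW tX) cg dg); apply: ge0_le_integral; first exact: measurable_itv.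
- by move=> x _; rewrite lee_fin.
- exact: measurable_EFin_continuous cFd.
- exact: measurable_EFin_continuous cg.
- move=> x /=; rewrite in_itv/= => /andP[tx xX]; have x01 : 0 <= x <= X.
    by rewrite xX (le_trans (ltW t0)).
  by rewrite lee_fin ler_wpM2r ?dens_ge0// F_small// super.
Qed.

Let int_Fdens t : t != 0 ->
  (\int[mu]_x (F x * dens x * ind t x)%:E <= (C * (W t * dens t))%:E)%E.
Proof.
move=> t0; have [t_lt0|t_gt0|] := ltgtP t 0; last by move/eqP: t0.
- rewrite (@integral_itv_ind _ (fun x => F x * dens x) (fun x => between t x) `]-oo, t]); last first.
    by move=> x; rewrite between_t_lt0.
  have cFd' : {within `]-oo, (- (- t))%R], continuous (fun x => F x * dens x)}.
    exact: continuous_subspaceT.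
  have := ge0_integration_by_substitutionNy cFd' (fun x _ => Fd0 x).
  rewrite opprK => ->.
  have := int_Fdens_pos (_ : 0 < - t); rewrite oppr_gt0 => /(_ t_lt0).
  rewrite WN densN; apply: le_trans.
  have -> : (fun x => F x * dens x) \o -%R = (fun x => F x * dens x).
    by apply/funext => x; rewrite /= FN densN.
  exact: lexx.
- rewrite (@integral_itv_ind _ (fun x => F x * dens x) (fun x => between t x) `[t, +oo[); last first.
    by move=> x; rewrite between_t_gt0.
  exact: int_Fdens_pos.
Qed.

Lemma supersolution_hardy u du : weak_derivative u du ->
  exists c, (\int[mu]_x ((u x - c) ^+ 2 * dens x)%:E <=
             C%:E * \int[mu]_t (du t ^+ 2 * dens t)%:E)%E.
Proof. by apply: (@weighted_hardy R W F). Qed.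

End Comparison.

End UpperBound.

(** * Variance, and existence of the best constant *)

Section Variance.
Context {R : realType}.
Notation mu := (@lebesgue_measure R).
Implicit Types (u du : R -> R) (a b c x : R).

Lemma L2nu_integrable_sqr u : L2nu u -> mu.-integrable [set: R] (fun x => (u x ^+ 2 * dens x)%:E).
Proof.
move=> [mu_ fin]; apply/integrableP; split.
  apply/measurable_EFinP; apply: measurable_funM; first exact: measurable_funX.
  exact: continuous_measurable_fun continuous_dens.
apply: le_lt_trans fin; rewrite le_eqVlt; apply/orP; left; apply/eqP.
apply: eq_integral => x _; rewrite abse_EFin ger0_norm// mulr_ge0 ?dens_ge0//.
exact: sqr_ge0.
Qed.

Lemma L2nu_integrable u : L2nu u -> mu.-integrable [set: R] (fun x => (u x * dens x)%:E).
Proof.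
move=> L2u; have i2 := L2nu_integrable_sqr L2u; case: L2u => mu_ _.
apply: le_integrable (integrableD _ i2 integrable_dens) => //.
  apply/measurable_EFinP; apply: measurable_funM => //.
  exact: continuous_measurable_fun continuous_dens.
move=> x _; rewrite /= lee_fin normrM.
have -> : u x ^+ 2 * dens x + dens x = (u x ^+ 2 + 1) * dens x by ring.
rewrite normrM ler_wpM2r// [leRHS]ger0_norm ?addr_ge0 ?sqr_ge0//.
have := sqr_ge0 (`|u x| - 1); rewrite -(real_normK (num_real (u x))).
have := sqr_ge0 `|u x|; rewrite sqrrB1.
by move: (`|u x|) => y; rewrite mulr2n; lra.
Qed.

Lemma Rintegral_sub_sqr u c : L2nu u ->
  mu.-integrable [set: R] (fun x => ((u x - c) ^+ 2 * dens x)%:E) /\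
  Rintegral mu setT (fun x => (u x - c) ^+ 2 * dens x) =
  Rintegral mu setT (fun x => u x ^+ 2 * dens x) -
    2 * c * Rintegral mu setT (fun x => u x * dens x) + c ^+ 2 * Defs.Z.
Proof.
move=> L2u; have i2 := L2nu_integrable_sqr L2u; have i1 := L2nu_integrable L2u.
have i0 := @integrable_dens R.
have i1c : mu.-integrable [set: R] (fun x => (- (2 * c) * (u x * dens x))%:E).
  exact: integrableZl i1.
have i0c : mu.-integrable [set: R] (fun x => (c ^+ 2 * dens x)%:E).
  exact: integrableZl i0.
have i21 : mu.-integrable [set: R] (fun x => (u x ^+ 2 * dens x + - (2 * c) * (u x * dens x))%:E).
  exact: integrableD i2 i1c.
have E : (fun x => (u x - c) ^+ 2 * dens x) =
    (fun x => (u x ^+ 2 * dens x + - (2 * c) * (u x * dens x)) + c ^+ 2 * dens x).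
  by apply/funext => x; ring.
split.
  have -> : (fun x => ((u x - c) ^+ 2 * dens x)%:E) =
      (fun x => (u x ^+ 2 * dens x + - (2 * c) * (u x * dens x))%:E + (c ^+ 2 * dens x)%:E)%E.
    by apply/funext => x; rewrite -EFinD; congr EFin; ring.
  exact: integrableD i21 i0c.
by rewrite E RintegralD// RintegralD// !RintegralZl// mulNr.
Qed.

(** The difference of the two sides is the square of [c] minus the mean of [u]. *)
Lemma variance_le u c : L2nu u ->
  nu_int (fun x => u x ^+ 2) - nu_int u ^+ 2 <= nu_int (fun x => (u x - c) ^+ 2).
Proof.
move=> /(Rintegral_sub_sqr c)[_]; rewrite /nu_int => ->.
have Z0 := @int_dens_gt0 R; move: Z0.
move: (Rintegral _ _ _) (Rintegral _ _ _) (Defs.Z) => B A Z Z0.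
rewrite -subr_ge0.
have -> : (A - 2 * c * B + c ^+ 2 * Z) / Z - (A / Z - (B / Z) ^+ 2) = (c - B / Z) ^+ 2.
  by field; rewrite gt_eqF.
exact: sqr_ge0.
Qed.

Lemma hardy_poincare (C : R) :
  (forall u du, weak_derivative u du ->
    exists c, (\int[mu]_x ((u x - c) ^+ 2 * dens x)%:E <=
               C%:E * \int[mu]_t (du t ^+ 2 * dens t)%:E)%E) ->
  poincare_const C.
Proof.
move=> H u du [L2u [wd L2du]]; have [c Hc] := H _ _ wd.
apply: le_trans (variance_le c L2u) _; rewrite /nu_int mulrA ler_pM2r ?invr_gt0 ?int_dens_gt0//.
have [ic _] := Rintegral_sub_sqr c L2u; have id := L2nu_integrable_sqr L2du.
(* Membership in [L2nu] makes both integrals finite, so [fine] does not send an infinite value to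
   0. *)
rewrite -lee_fin EFinM /Rintegral !fineK//; exact: integrable_fin_num.
Qed.

(** The infimum is itself admissible: for fixed [u] with positive energy the condition on [C] is a
    closed half-line, and for zero energy it does not involve [C], so it is inherited from [C0]. *)
Lemma best_poincare_const (c0 C0 : R) : poincare_const C0 ->
  (forall C : R, poincare_const C -> c0 <= C) ->
  exists CP : R, poincare_const CP /\ (forall C, poincare_const C -> CP <= C) /\
    c0 <= CP <= C0.
Proof.
move=> PC0 lb; pose S := [set C : R | poincare_const C].
have infS : has_inf S by split; [exists C0|exists c0].
have CPle C : poincare_const C -> inf S <= C by move=> PC; apply: ge_inf => //; exists c0.
exists (inf S); split; last first.
  by split => //; rewrite CPle// andbT; apply: lb_le_inf; [exists C0|].
move=> u du Hu; have := PC0 _ _ Hu.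
set A := _ - _; set B := nu_int _ => AB0.
have B0 : 0 <= B.
  rewrite /B /nu_int divr_ge0 ?(ltW (@int_dens_gt0 R))//.
  by apply: Rintegral_ge0 => x _; rewrite mulr_ge0 ?dens_ge0 ?sqr_ge0.
have [B_gt0|B_le0] := ltP 0 B; last first.
  have -> : B = 0 by apply/le_anti; rewrite B_le0 B0.
  by move: AB0; have -> : B = 0 by [apply/le_anti; rewrite B_le0 B0]; rewrite !mulr0.
rewrite -ler_pdivrMr//; apply: lb_le_inf; first by exists C0.
by move=> C PC; rewrite ler_pdivrMr//; exact: PC.
Qed.

End Variance.

(** * From a subsolution to a lower bound *)

Section LowerBound.
Context {R : realType}.
Notation mu := (@lebesgue_measure R).
Implicit Types (u du g : R -> R) (a b c x : R).

Lemma continuous_integrable_itv g a b : continuous g -> mu.-integrable `[a, b] (EFin \o g).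
Proof. by move=> cg; apply/locally_integrable_itv/continuous_locally_integrable. Qed.

Lemma Rintegral_split g a x b : continuous g -> a <= x -> x <= b ->
  Rintegral mu `[a, b] g = Rintegral mu `[a, x] g + Rintegral mu `[x, b] g.
Proof.
move=> cg ax xb; have := @Rintegral_itvB R g (BLeft a) (BRight b) x (continuous_integrable_itv a b cg).
rewrite !bnd_simp => /(_ ax xb) E.
rewrite -(Rintegral_itv_obnd_cbnd (r := x)) -?E; first by rewrite addrC subrK.
apply: integrableS (continuous_integrable_itv x b cg) => //.
exact: subset_itv_oc_cc.
Qed.

Lemma FTC_Rintegral (f F : R -> R) a b : a <= b -> continuous f ->
  (forall x : R, is_derive x 1 F (f x)) -> Rintegral mu `[a, b] f = F b - F a.
Proof. by move=> ab cf dF; rewrite /Rintegral (FTC_itv ab cf dF). Qed.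

Lemma Rintegral_gt0 g : continuous g -> (forall x, 0 <= g x) -> 0 < g 0 ->
  mu.-integrable [set: R] (EFin \o g) -> 0 < Rintegral mu setT g.
Proof.
move=> cg g0 gpos ig.
have : \forall x \near (0 : R), g 0 / 2 < g x.
  by apply: (cvgr_gt _ (cg 0)); rewrite ltr_pdivrMr// ltr_pMr// ltr1n.
move=> [r /= r0 Hr].
have mg (D : set R) : measurable_fun D (EFin \o g).
  by apply/measurable_EFinP; apply: measurable_funTS; exact: continuous_measurable_fun.
have mball : measurable (ball (0 : R) r) by exact: measurable_ball.
have g2 : 0 < g 0 / 2 by rewrite divr_gt0.
rewrite /Rintegral fine_gt0//; apply/andP; split; last first.
  by have := integrable_fin_num measurableT ig => /fin_numPlt/andP[].
apply: lt_le_trans (_ : (\int[mu]_(x in ball (0%R : R) r) (g 0%R / 2)%:E <= _)%E).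
  rewrite integral_cst//= lebesgue_measure_ball ?(ltW r0)//.
  by rewrite -EFinM lte_fin mulr_gt0// mulrn_wgt0.
apply: le_trans (_ : (\int[mu]_(x in ball (0%R : R) r) (g x)%:E <= _)%E).
  apply: ge0_le_integral => //.
  - by move=> x _; rewrite lee_fin ltW.
  - exact: mg.
  - by move=> x /Hr; rewrite lee_fin => /ltW.
apply: ge0_subset_integral => //; first exact: mg.
by move=> x _; rewrite lee_fin.
Qed.

Lemma bounded_L2nu g (M : R) : continuous g -> (forall x, `|g x| <= M) -> L2nu g.
Proof.
move=> cg gM; split; first exact: continuous_measurable_fun.
have md := continuous_measurable_fun (@continuous_dens R).
apply: (@le_lt_trans _ _ (\int[mu]_x (M ^+ 2 * dens x)%:E)%E); last first.
  have i : mu.-integrable [set: R] (fun x => (M ^+ 2 * dens x)%:E).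
    exact: integrableZl (@integrable_dens R).
  by have := integrable_fin_num measurableT i => /fin_numPlt/andP[].
apply: ge0_le_integral => //.
- by move=> x _; rewrite lee_fin mulr_ge0 ?dens_ge0 ?sqr_ge0.
- by apply/measurable_EFinP; apply: measurable_funM => //; apply: measurable_funX; exact: continuous_measurable_fun.
- by apply/measurable_EFinP; apply: measurable_funM.
- move=> x _; rewrite lee_fin ler_wpM2r ?dens_ge0// -(real_normK (num_real (g x))).
  by rewrite lerXn2r// nnegrE// (le_trans _ (gM x)).
Qed.

(** The sign condition allows the reflection of the left half-line by the substitution rule for
    nonnegative integrands, applied to [- g]. *)
Lemma nu_int_odd g : continuous g -> (forall x, g (- x) = - g x) ->
  (forall x, 0 <= x -> 0 <= g x) -> mu.-integrable [set: R] (EFin \o g) ->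
  Rintegral mu setT g = 0.
Proof.
move=> cg godd g0 ig.
have cNg : continuous (fun x => - g x) by exact: continuousNR.
have := @Rintegral_itvB R g -oo%O +oo%O 0; rewrite set_itvNyy => /(_ ig isT isT).
have mg (D : set R) : measurable_fun D (EFin \o g).
  by apply/measurable_EFinP; apply: measurable_funTS; exact: continuous_measurable_fun.
have iS (i : interval R) : mu.-integrable [set` i] (EFin \o g) by exact: integrableS ig.
rewrite (Rintegral_itv_obnd_cbnd (r := 0)) //.
have : Rintegral mu `]-oo, 0] (fun x => - g x) = Rintegral mu `[0, +oo[ g.
  rewrite /Rintegral; congr fine.
  have cs : {within `]-oo, (- (0 : R))%R], continuous (fun x => - g x)}.
    exact: continuous_subspaceT.
  have := ge0_integration_by_substitutionNy cs; rewrite oppr0 => ->.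
    by apply: eq_integral => x _; rewrite /= godd opprK.
  move=> x; rewrite in_itv/= => x0; rewrite -godd g0// oppr_ge0 ltW//.
have -> : Rintegral mu `]-oo, 0] (fun x => - g x) = - Rintegral mu `]-oo, 0] g.
  rewrite -mulN1r -RintegralZl//.
  by apply: eq_Rintegral => x _; rewrite mulN1r.
by move=> <- /eqP; rewrite subr_eq => /eqP ->; ring.
Qed.

Section Trial.
Variables (c X : R) (f w dw : R -> R).
Hypotheses (X0 : 0 < X) (fN : forall x, f (- x) = - f x).
Hypotheses (df : forall x : R, is_derive x 1 f (w x)) (d2f : forall x : R, is_derive x 1 w (dw x)).
Hypotheses (cdw : continuous dw) (wX : w X = 0) (wNX : w (- X) = 0) (w0 : w 0 != 0).
Hypothesis f_ge0 : forall x, 0 <= x <= X -> 0 <= f x.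
Hypothesis sub : forall x, `|x| <= X -> c * (f x * (dV x * w x - dw x)) <= f x ^+ 2.

(** Composing with [clamp] continues [f] by constants. As [w] vanishes at [X] and [- X], composing
    [w] in the same way gives the derivative of this continuation, and it is continuous. *)
Let clamp x : R := Num.max (- X) (Num.min x X).
Let u x : R := f (clamp x).
Let du x : R := w (clamp x).

Let NXX : - X <= X. Proof. by rewrite (@le_trans _ _ 0)// ?oppr_le0 ltW. Qed.

Let clamp_in x : - X <= x <= X -> clamp x = x.
Proof. by move=> /andP[h1 h2]; rewrite /clamp min_l// max_r. Qed.

Let clamp_lt x : x <= - X -> clamp x = - X.
Proof. by move=> h; rewrite /clamp min_l ?(le_trans h)// max_l. Qed.

Let clamp_gt x : X <= x -> clamp x = X.
Proof. by move=> h; rewrite /clamp min_r// max_r. Qed.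

Let clamp_itv x : - X <= clamp x <= X.
Proof. by rewrite /clamp le_max lexx/= ge_max NXX/= ge_min lexx orbT. Qed.

Let cclamp : continuous clamp.
Proof.
have cmin : continuous (fun x : R => Num.min x X).
  by move=> x; apply: (@continuous_min _ _ (fun x : R => x) (fun=> X)); [exact: cvg_id|exact: cst_continuous].
by move=> x; apply: (@continuous_max _ _ (fun=> - X) (fun x : R => Num.min x X)); [exact: cst_continuous|exact: cmin].
Qed.

Let cf : continuous f. Proof. exact: is_derive_continuousT df. Qed.
Let cw : continuous w. Proof. exact: is_derive_continuousT d2f. Qed.
Let cu : continuous u. Proof. exact: continuous_compR cclamp cf. Qed.
Let cdu : continuous du. Proof. exact: continuous_compR cclamp cw. Qed.

Let bounded_clamp g : continuous g -> exists M : R, forall x, `|g (clamp x)| <= M.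
Proof.
move=> cg; have [d _ dM] := @EVT_max R (fun x => `|g x|) (- X) X NXX
  (continuous_subspaceT (fun x => cvg_norm (cg x))).
by exists `|g d| => x; apply: dM; rewrite in_itv/= clamp_itv.
Qed.

Let L2u : L2nu u.
Proof. by have [M] := bounded_clamp cf; exact: bounded_L2nu cu. Qed.

Let L2du : L2nu du.
Proof. by have [M] := bounded_clamp cw; exact: bounded_L2nu cdu. Qed.

(** The product rule on three intervals: the constant pieces contribute [f (- X)] and [f X] times
    increments of [phi], and the boundary terms at [- X] and [X] telescope. *)
Let int_product (phi dphi : R -> R) (N : R) : X <= N -> continuous dphi ->
  (forall x : R, is_derive x 1 phi (dphi x)) -> phi N = 0 -> phi (- N) = 0 ->
  Rintegral mu `[- N, N] (fun x => u x * dphi x + du x * phi x) = 0.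
Proof.
move=> XN cdphi dphi_ phiN phiNN; have cphi := is_derive_continuousT dphi_.
have ch : continuous (fun x => u x * dphi x + du x * phi x).
  by apply: continuousDR; exact: continuousMR.
have NNX : - N <= - X by rewrite lerN2.
rewrite (Rintegral_split ch NNX (le_trans NXX XN)) (Rintegral_split ch NXX XN).
have outer a b (k : R) : a <= b -> (forall x, a <= x <= b -> u x = k /\ du x = 0) ->
    Rintegral mu `[a, b] (fun x => u x * dphi x + du x * phi x) = k * phi b - k * phi a.
  move=> ab ukd.
  have -> : Rintegral mu `[a, b] (fun x => u x * dphi x + du x * phi x) =
      Rintegral mu `[a, b] (fun x => k * dphi x).
    apply: eq_Rintegral => x; rewrite mem_setE in_itv/= => /ukd[-> ->].
    by rewrite mul0r addr0.
  have dk (x : R) : is_derive x 1 (fun y => k * phi y) (k * dphi x).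
    have dc : is_derive x 1 (fun=> k) 0 by exact: is_derive_cst.
    by have := is_derive_mul dc (dphi_ x); rewrite mul0r add0r.
  have ck : continuous (fun x => k * dphi x) by apply: continuousMR => // x; exact: cvg_cst.
  by rewrite (FTC_Rintegral ab ck dk).
rewrite (outer _ _ (f (- X)) NNX); last first.
  by move=> x /andP[_ h]; rewrite /u /du clamp_lt.
rewrite (outer _ _ (f X) XN); last first.
  by move=> x /andP[h _]; rewrite /u /du clamp_gt.
have -> : Rintegral mu `[- X, X] (fun x => u x * dphi x + du x * phi x) =
    Rintegral mu `[- X, X] (fun x => w x * phi x + f x * dphi x).
  apply: eq_Rintegral => x; rewrite mem_setE in_itv/= => xX.
  by rewrite /u /du clamp_in// addrC.
have cg : continuous (fun x => w x * phi x + f x * dphi x) by apply: continuousDR; exact: continuousMR.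
have dg (x : R) := is_derive_mul (df x) (dphi_ x).
rewrite (FTC_Rintegral NXX cg dg).
by rewrite phiN phiNN !mulr0; ring.
Qed.

Let wd : weak_derivative u du.
Proof.
have lu := continuous_locally_integrable cu; have ldu := continuous_locally_integrable cdu.
split => //; split => // phi [dphi_ [M phiM]].
have d0 (x : R) : is_derive x 1 phi (derive1 phi x).
  by apply: DeriveDef; [exact: (dphi_ 0%N)|rewrite derive1E].
have d1 (x : R) : is_derive x 1 (derive1 phi) (derive1 (derive1 phi) x).
  by apply: DeriveDef; [exact: (dphi_ 1%N)|rewrite derive1E].
have cphi := is_derive_continuousT d0; have cdphi := is_derive_continuousT d1.
pose N := Num.max M X + 1.
have MN : M < N by rewrite /N (@le_lt_trans _ _ (Num.max M X)) ?le_max ?lexx// ltrDl.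
have XN : X < N by rewrite /N (@le_lt_trans _ _ (Num.max M X)) ?le_max ?lexx ?orbT// ltrDl.
have N0 : 0 < N := lt_trans X0 XN.
have out x : ~~ (- N <= x <= N) -> M < `|x|.
  by rewrite -ler_norml -ltNge; exact: lt_trans.
have phi0 x : ~~ (- N <= x <= N) -> phi x = 0 by move/out; exact: phiM.
have dphi0 x : ~~ (- N <= x <= N) -> derive1 phi x = 0.
  move=> /out Mx; have H : is_derive x 1 phi 0.
    have : is_derive x 1 (fun=> 0 : R) (0 : R) by exact: is_derive_cst.
    have cn : continuous (fun y : R => `|y|) by move=> y; exact: norm_continuous.
    have nx := cvgr_gt _ (cn x) _ Mx.
    by apply: near_eq_is_derive; near=> y; rewrite phiM//; near: y; exact: nx.
  by rewrite -(@derive_val _ _ _ _ _ _ _ (d0 x)) (@derive_val _ _ _ _ _ _ _ H).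
have XleN := ltW XN.
have phiN : phi N = 0 by rewrite phiM// gtr0_norm.
have phiNN : phi (- N) = 0 by rewrite phiM// normrN gtr0_norm.
have := int_product XleN cdphi d0 phiN phiNN.
have i1 : mu.-integrable `[(- N), N] (EFin \o (fun x => u x * derive1 phi x)).
  by apply: continuous_integrable_itv; exact: continuousMR.
have i2 : mu.-integrable `[(- N), N] (EFin \o (fun x => du x * phi x)).
  by apply: continuous_integrable_itv; exact: continuousMR.
rewrite RintegralD//= => /eqP; rewrite addr_eq0 => /eqP E.
rewrite (@Rintegral_supp R (fun x => u x * derive1 phi x) (- N) N); last first.
  by move=> x /dphi0 ->; rewrite mulr0.
rewrite (@Rintegral_supp R (fun x => du x * phi x) (- N) N) ?E//.
by move=> x /phi0 ->; rewrite mulr0.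
Unshelve. all: by end_near. Qed.

(** Integrate the derivative of [f w exp (- V)]; the boundary terms vanish because [w] does at both
    ends. *)
Let int_energy : Rintegral mu `[- X, X] (fun x => w x ^+ 2 * dens x) =
  Rintegral mu `[- X, X] (fun x => f x * (dV x * w x - dw x) * dens x).
Proof.
have cd := @continuous_dens R; have cV := @continuous_dV R.
have c1 : continuous (fun x => w x ^+ 2 * dens x) by apply: continuousMR => //; exact: continuousXR.
have c2 : continuous (fun x => f x * (dV x * w x - dw x) * dens x).
  apply: continuousMR => //; apply: continuousMR => //; apply: continuousDR; first exact: continuousMR.
  exact: continuousNR.
have cg : continuous (fun x => w x ^+ 2 * dens x - f x * (dV x * w x - dw x) * dens x).
  by apply: continuousDR => //; exact: continuousNR.
have dg (x : R) : is_derive x 1 (fun y => f y * (w y * dens y))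
    (w x ^+ 2 * dens x - f x * (dV x * w x - dw x) * dens x).
  have := is_derive_mul (df x) (is_derive_mul (d2f x) (is_derive_dens x)).
  by congr (is_derive _ _ _ _); ring.
have := FTC_Rintegral NXX cg dg; rewrite wX wNX !mul0r !mulr0 subrr.
rewrite RintegralB//; [|exact: continuous_integrable_itv|exact: continuous_integrable_itv].
by move=> /eqP; rewrite subr_eq0 => /eqP.
Qed.

Lemma subsolution_poincare (C : R) : poincare_const C -> c <= C.
Proof.
move=> PC; have := PC u du (conj L2u (conj wd L2du)).
have cd := @continuous_dens R; have Z0 := @int_dens_gt0 R.
have uN x : u (- x) = - u x.
  rewrite /u; have [xX|xX] := leP x X; last first.
    by rewrite (clamp_gt (ltW xX)) clamp_lt ?fN// lerN2 ltW.
  have [Xx|Xx] := leP (- X) x.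
    by rewrite !clamp_in ?fN ?Xx// lerN2 xX lerNl Xx.
  by rewrite (clamp_lt (ltW Xx)) clamp_gt -?fN ?opprK// lerNr ltW.
have u0 x : 0 <= x -> 0 <= u x.
  move=> x0; rewrite /u; have [xX|Xx] := leP x X.
    by rewrite clamp_in ?f_ge0 ?x0// xX andbT (@le_trans _ _ 0)// oppr_le0 ltW.
  by rewrite clamp_gt ?f_ge0 ?lexx ?ltW.
have mean0 : nu_int u = 0.
  rewrite /nu_int (@nu_int_odd (fun x => u x * dens x)) ?mul0r//.
  - exact: continuousMR.
  - by move=> x; rewrite uN densN mulNr.
  - by move=> x x0; rewrite mulr_ge0 ?dens_ge0 ?u0.
  - exact: L2nu_integrable.
rewrite mean0 expr0n subr0 /nu_int mulrA ler_pM2r ?invr_gt0//.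
have iu := L2nu_integrable_sqr L2u; have idu := L2nu_integrable_sqr L2du.
(* Positive energy, from [w 0 != 0] and continuity, lets the factor be cancelled from the Poincare
   inequality. *)
have D0 : 0 < Rintegral mu setT (fun x => du x ^+ 2 * dens x).
  apply: Rintegral_gt0 => //.
  - by apply: continuousMR => //; exact: continuousXR.
  - by move=> x; rewrite mulr_ge0 ?dens_ge0 ?sqr_ge0.
  - rewrite mulr_gt0 ?dens_gt0// /du clamp_in ?oppr_le0 ?(ltW X0)//.
    by rewrite exprn_even_gt0.
move=> H; rewrite -(ler_pM2r D0); apply: le_trans H.
have -> : Rintegral mu setT (fun x => du x ^+ 2 * dens x) =
    Rintegral mu `[- X, X] (fun x => w x ^+ 2 * dens x).
  rewrite (@Rintegral_supp R _ (- X) X); last first.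
    move=> x; rewrite negb_and -!ltNge /du => /orP[/ltW/clamp_lt ->|/ltW/clamp_gt ->].
      by rewrite wNX expr0n mul0r.
    by rewrite wX expr0n mul0r.
  by apply: eq_Rintegral => x; rewrite mem_setE in_itv/= => xX; rewrite /du clamp_in.
rewrite int_energy -RintegralZl//; last first.
  apply: continuous_integrable_itv; apply: continuousMR => //; apply: continuousMR => //.
  by apply: continuousDR; [apply: continuousMR => //; exact: continuous_dV|exact: continuousNR].
have cg : continuous (fun x => u x ^+ 2 * dens x) by apply: continuousMR => //; exact: continuousXR.
(* Here the part of [nu (u^2)] beyond [X] is given up. *)
apply: (@le_trans _ _ (Rintegral mu `[- X, X] (fun x => u x ^+ 2 * dens x))).
  apply: le_Rintegral => //.
  - apply: continuous_integrable_itv; apply: continuousMR; first by move=> x; exact: cvg_cst.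
    apply: continuousMR => //; apply: continuousMR => //.
    by apply: continuousDR; [apply: continuousMR => //; exact: continuous_dV|exact: continuousNR].
  - exact: continuous_integrable_itv.
  - move=> x /=; rewrite in_itv/= => xX; rewrite mulrA ler_wpM2r ?dens_ge0//.
    by rewrite /u clamp_in// sub// ler_norml.
rewrite /Rintegral fine_le//.
- exact: integrable_fin_num (continuous_integrable_itv _ _ cg).
- exact: integrable_fin_num iu.
- apply: ge0_subset_integral => //.
  + exact: measurable_EFin_continuous cg.
  + by move=> x _; rewrite lee_fin mulr_ge0 ?dens_ge0 ?sqr_ge0.
Qed.

End Trial.

End LowerBound.

(** * Sign certificates for integer polynomials *)

Section ZPoly.
Local Open Scope Z_scope.

Fixpoint zadd (p q : seq Z) : seq Z :=
  match p, q with
  | [::], _ => q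
  | _, [::] => p
  | a :: p', b :: q' => (a + b) :: zadd p' q'
  end.

Definition zscale (c : Z) (p : seq Z) : seq Z := [seq c * a | a <- p].

Fixpoint zderiv (p : seq Z) : seq Z :=
  match p with
  | [::] => [::]
  | _ :: p' => zadd p' (0 :: zderiv p')
  end.

(** The polynomial [p (x / 2)] times [2^(deg p)]: the factor keeps the coefficients integral and
    does not affect signs. *)
Fixpoint zhalf (p : seq Z) : seq Z :=
  match p with
  | [::] => [::]
  | a :: p' => a * 2 ^ Z.of_nat (size p') :: zhalf p'
  end.

Fixpoint zshift (p : seq Z) : seq Z :=
  match p with
  | [::] => [::]
  | a :: p' => let r := zshift p' in zadd r (a :: r)
  end.

(** A sufficient test for nonnegativity on [[0, 1]], by Abel summation: the polynomial is a
    combination of the nonnegative [x^k - x^(k+1)] and of its last power, with the partial sums as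
    coefficients. *)
Fixpoint partial_sums_ge0 (s : Z) (p : seq Z) : bool :=
  match p with
  | [::] => true
  | a :: p' => (0 <=? s + a) && partial_sums_ge0 (s + a) p'
  end.

(** Bisection of [[0, 1]] to depth [n], each half being rescaled to [[0, 1]]. Nested [if] instead of
    boolean connectives keeps the call-by-value evaluation from exploring branches already
    decided. *)
Fixpoint zpos01 (n : nat) (p : seq Z) : bool :=
  if partial_sums_ge0 0 p then true else
  match n with
  | 0%N => false
  | n'.+1 => let h := zhalf p in if zpos01 n' h then zpos01 n' (zshift h) else false
  end.

End ZPoly.

Section ZPolyEval.
Context {R : realType}.
Implicit Types (a b c s : Z) (p q : seq Z) (x : R).

Definition zr (z : Z) : R := (int_of_Z z)%:~R.

Lemma zrD a b : zr (Z.add a b) = zr a + zr b.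
Proof. by rewrite /zr -[Z.add a b]/(a + b) rmorphD /= intrD. Qed.

Lemma zrM a b : zr (Z.mul a b) = zr a * zr b.
Proof. by rewrite /zr -[Z.mul a b]/(a * b) rmorphM /= intrM. Qed.

Lemma zr_ge0 a : Z.leb Z0 a -> 0 <= zr a.
Proof. by rewrite /zr ler0z; case: a => //= p. Qed.

Lemma zr_exp2 n : zr (Z.pow (Zpos 2) (Z.of_nat n)) = 2 ^+ n.
Proof.
elim: n => [|n IHn]; first by rewrite expr0.
by rewrite Nat2Z.inj_succ (Z.pow_succ_r _ _ (Nat2Z.is_nonneg n)) zrM IHn exprS.
Qed.

Lemma zr_nat n : zr (Z.of_nat n) = n%:R.
Proof. by rewrite /zr; case: n => // n; rewrite /= SuccNat2Pos.id_succ. Qed.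

Lemma zrN a : zr (Z.opp a) = - zr a.
Proof. by rewrite /zr -[Z.opp a]/(- a) rmorphN intrN. Qed.

Lemma zr_le a b : Z.leb a b -> zr a <= zr b.
Proof.
move=> ab; rewrite -subr_ge0 -zrN -zrD; apply: zr_ge0.
by apply/Z.leb_le; rewrite Z.add_opp_r; apply/Z.le_0_sub/Z.leb_le.
Qed.

Lemma zr_eq0 a : (zr a == 0) = (a == Z0).
Proof. by rewrite /zr intr_eq0 -[0]/(int_of_Z Z0) (can_eq int_of_ZK). Qed.

Fixpoint zeval p x : R := if p is a :: p' then zr a + x * zeval p' x else 0.

Lemma zeval_cons a p x : zeval (a :: p) x = zr a + x * zeval p x.
Proof. by []. Qed.

Lemma zeval_nil x : zeval [::] x = 0.
Proof. by []. Qed.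

Lemma zeval0 p : zeval p 0 = zr (head Z0 p).
Proof. by case: p => [|a p] /=; rewrite ?mul0r ?addr0// (zr_nat 0). Qed.

Lemma zevalD p q x : zeval (zadd p q) x = zeval p x + zeval q x.
Proof.
elim: p q => [|a p IHp] [|b q] /=; rewrite ?add0r ?addr0 //.
rewrite zrD IHp. ring.
Qed.

Lemma zevalZ c p x : zeval (zscale c p) x = zr c * zeval p x.
Proof. by elim: p => [|a p IHp] /=; rewrite ?mulr0 // zrM IHp; ring. Qed.

Lemma zeval_half p x : zeval (zhalf p) x = 2 ^+ (size p).-1 * zeval p (x / 2).
Proof.
elim: p => [|a p IHp] /=; first by rewrite mulr0.
rewrite zrM zr_exp2 IHp; case: p {IHp} => [|b p] /=; first by ring.
by rewrite exprS; field.
Qed.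

Lemma zeval_shift p x : zeval (zshift p) x = zeval p (x + 1).
Proof.
elim: p => [//|a p IHp]; rewrite /= zevalD /= IHp.
by ring.
Qed.

Lemma partial_sums_ge0P s p x : 0 <= zr s -> partial_sums_ge0 s p -> 0 <= x <= 1 ->
  0 <= zr s + x * zeval p x.
Proof.
move=> + + /andP[x0 x1]; elim: p s => [|a p IHp] s s0 /=; first by rewrite mulr0 addr0.
move=> /andP[/zr_ge0 sa0 /(IHp _ sa0)]; rewrite zrD => H.
(* Abel summation one coefficient at a time: a convex combination of the current partial sum and of
   the expression for the next one. *)
have : 0 <= (1 - x) * zr s + x * (zr s + zr a + x * zeval p x).
  by rewrite addr_ge0// mulr_ge0// subr_ge0.
by congr (0 <= _); ring.
Qed.

Lemma zpos01P n p x : zpos01 n p -> 0 <= x <= 1 -> 0 <= zeval p x.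
Proof.
elim: n p x => [|n IHn] p x.
  rewrite [zpos01 _ _]/=; case: ifP => // H _ x01.
  case: p H => // a p /= /andP[/zr_ge0 a0 H].
  by rewrite -[a]Z.add_0_l; apply: partial_sums_ge0P.
rewrite [zpos01 _ _]/=; case: ifP => [H _ x01|_].
  case: p H => // a p /= /andP[/zr_ge0 a0 H].
  by rewrite -[a]Z.add_0_l; apply: partial_sums_ge0P.
case: ifP => // H1 H2 /andP[x0 x1].
have e2 : (0 : R) < 2 ^+ (size p).-1 by rewrite exprn_gt0.
have [xh|xh] := leP (x * 2) 1.
  have := IHn _ (x * 2) H1; rewrite zeval_half mulfK// (pmulr_rge0 _ e2); apply.
  by rewrite xh andbT mulr_ge0.
have := IHn _ (x * 2 - 1) H2; rewrite zeval_shift subrK zeval_half mulfK// (pmulr_rge0 _ e2).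
by apply; apply/andP; split; lra.
Qed.

Lemma is_derive_zeval p x : is_derive x 1 (zeval p) (zeval (zderiv p) x).
Proof.
elim: p x => [|a p IHp] x; first exact: is_derive_cst.
have := is_deriveD (is_derive_cst (zr a : R) x 1) (is_deriveM (is_derive_id x (1 : R)) (IHp x)).
by congr (is_derive _ _ _ _); rewrite /= zevalD/= /GRing.scale/= /zr/=; ring.
Qed.

End ZPolyEval.

(** * The two trial functions *)

Section TrialData.
Local Open Scope Z_scope.

(* If [f x = x * q (x^2 / T)], then [f' x = zslope q (x^2 / T)] and
   [T D (V' f' - f'') - T N f = x * zresidual T N D q (x^2 / T)]. *)
Definition zslope (q : seq Z) : seq Z := zadd q (zscale 2 (0 :: zderiv q)).

Definition zresidual (T N D : Z) (q : seq Z) : seq Z :=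
  let w := zslope q in
  zadd (zadd (zscale (T * T * D) (0 :: w)) (zscale (- (4 * T * D)) w))
       (zadd (zscale (- (2 * D)) (zderiv w)) (zscale (- (T * N)) q)).

(** Scaled so that [f' 0] is about [2^54]; here [T = 13]. The constant 33.58004219 is only about
    [9e-9] below the optimum. Cutting at [X^2 = 13] costs a few [1e-9], through the factor
    [nu (|x| > X)]; cutting at [X^2 = 12] would cost more than [1e-7]. *)
Definition lower_coefs : seq Z := [::
  18014398509481826; -157287120248414909; 1382105770539839462; -10467312651131248114;
  69194908716343144921; -407207586769003427691; 2168754824759225192364;
  -10590061041503703907880; 47900626415032313824618; -202354275013108067996540;
  803705008733969176037152; -3017084808046108175743999; 10746482502774946257478972;
  -36394723805707673147973382; 117146162920296075743737851; -357022578255036729267500962;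
  1022060963437691932013146106; -2713045316741715140808910743;
  6551034331621878825938783109; -13972317613885458197736994186;
  24950958877018860556873242591; -32419199204071795879031038011;
  10630231424429370050066197522; 101099836123442076529200676780;
  -408514630412721173128473243626; 1045043995621458086144642928651;
  -2107827682446386581806537196231; 3557910601895755024172917802614;
  -5144560358382410132837415745108; 6437211472973126501468573882229;
  -6997204495398977264360099427217; 6608592328355177541529246424033;
  -5409754529891227222266738563862; 3819861191711120288812065960743;
  -2309902154500806947006519868708; 1184310288244497284089441517569;
  -507841924182224250710633010818; 178742212145629905634971938210;
  -50285655394747376894040074758; 10871827285269071416405383814;
  -1695788740787944534313694348; 169844795710995628663614871; -8202004074440714221029517].

(** Scaled so that [f' 0 = 2^44]; here [T = 12]. The constant 33.58004265 leaves a margin of about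
    [4.5e-7], hence a shorter expansion than for the lower bound. *)
Definition upper_coefs : seq Z := [::
  17592186044416; -141785264639901; 1150051029406340; -8039868044825678; 49059798212328387;
  -266504996221995812; 1310200342278644907; -5905582044263052394; 24656910643118330980;
  -96145288344522703460; 352436647965712661468; -1220695106095703702897;
  4008895824648038789715; -12502676079817728253977; 36996835745119210354786;
  -103507663300757351005514; 272152631533753597788769; -667246623602439565659547;
  1512217367201744164670838; -3140540958278024186810738; 5927820574666599028504769;
  -10093619022111886975160779; 15400012380996329522827663; -20921083441715496768234153;
  25152268841252060386992179; -26592901863153083987795521; 24557048867365901196903761;
  -19652097065227089620615654; 13502380109827045295186606; -7873526443282241278793578;
  3839525874396474441926582; -1535467297399479526259891; 490116681883358640593216;
  -120007209538336739953823; 21155167584335602983292; -2389186496839250432629;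
  129788588234998899817].

(** The test [zpos01] shows only nonnegativity; subtracting 1, tiny at this scale, makes the sign
    strict. *)
Lemma upper_slope_gt0 : zpos01 10 (zadd [:: -1] (zslope upper_coefs)).
Proof. by vm_cast_no_check (erefl true). Qed.

Lemma upper_coefs_gt0 : zpos01 10 (zadd [:: -1] upper_coefs).
Proof. by vm_cast_no_check (erefl true). Qed.

Lemma upper_residual_ge0 : zpos01 10 (zresidual 12 100000000 3358004265 upper_coefs).
Proof. by vm_cast_no_check (erefl true). Qed.

(** The hypothesis [superX] divided by [X]: a sum of coefficients is a value at 1, and
    [dV X = 8 * X] when [X^2 = 12]. *)
Lemma upper_endpoint :
  100000000 * foldr Z.add 0 upper_coefs <=?
  3358004265 * (8 * foldr Z.add 0 (zslope upper_coefs)).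
Proof. by vm_cast_no_check (erefl true). Qed.

Lemma lower_coefs_ge0 : zpos01 10 lower_coefs.
Proof. by vm_cast_no_check (erefl true). Qed.

Lemma lower_residual_le0 :
  zpos01 10 (zscale (-1) (zresidual 13 100000000 3358004219 lower_coefs)).
Proof. by vm_cast_no_check (erefl true). Qed.

(** An exact equality, since [f' X = 0] admits no tolerance. The constant coefficient has weight 1
    in this sum, so an integer shift of it is enough to reach 0. *)
Lemma lower_endpoint : foldr Z.add 0 (zslope lower_coefs) = 0.
Proof. by vm_cast_no_check (erefl (0 : Z)). Qed.

Lemma lower_coefs_head : head 0 lower_coefs != 0.
Proof. by vm_cast_no_check (erefl true). Qed.

End TrialData.

(** * From integer coefficients to real trial functions *)

Section Trial.
Context {R : realType}.
Implicit Types (q : seq Z) (T N D : Z) (x : R).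

Definition trial q T x : R := x * zeval q (x ^+ 2 / zr T).
Definition trial_d q T x : R := zeval (zslope q) (x ^+ 2 / zr T).
Definition trial_dd q T x : R :=
  zeval (zderiv (zslope q)) (x ^+ 2 / zr T) * (x * 2 / zr T).

Lemma zeval_slope q x : zeval (zslope q) x = zeval q x + x * 2 * zeval (zderiv q) x.
Proof. by rewrite /zslope zevalD zevalZ zeval_cons (zr_nat 0) (zr_nat 2); ring. Qed.

Lemma zeval1 q : zeval q (1 : R) = zr (foldr Z.add Z0 q).
Proof. by elim: q => [//|a q IHq] /=; rewrite zrD IHq mul1r. Qed.

Lemma is_derive_zeval_sqr q T x :
  is_derive x 1 (fun y => zeval q (y ^+ 2 / zr T) : R)
    (zeval (zderiv q) (x ^+ 2 / zr T) * (x * 2 / zr T)).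
Proof.
have H : is_derive x 1 (fun y : R => y ^+ 2 / zr T) (x * 2 / zr T).
  have := is_deriveM (is_deriveX 2 (is_derive_id x (1 : R)))
                     (is_derive_cst ((zr T)^-1 : R) x 1).
  by congr (is_derive _ _ _ _); rewrite /= /GRing.scale/=; ring.
have := @is_derive1_comp R (zeval q) (fun y => y ^+ 2 / zr T) x _ _ (is_derive_zeval q _) H.
by congr (is_derive _ _ _ _).
Qed.

Lemma is_derive_trial q T x : is_derive x 1 (trial q T) (trial_d q T x).
Proof.
have := is_deriveM (is_derive_id x (1 : R)) (is_derive_zeval_sqr q T x).
congr (is_derive _ _ _ _); rewrite /trial_d zeval_slope /GRing.scale/=; ring.
Qed.

Lemma is_derive_trial_d q T x : is_derive x 1 (trial_d q T) (trial_dd q T x).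
Proof. exact: is_derive_zeval_sqr. Qed.

Lemma continuous_trial_dd q T : continuous (trial_dd q T).
Proof.
move=> x; apply: cvgM; first exact: is_derive_continuous (is_derive_zeval_sqr _ _ _).
by apply: cvgM; [apply: cvgM; [exact: cvg_id|exact: cvg_cst]|exact: cvg_cst].
Qed.

Lemma trialN q T x : trial q T (- x) = - trial q T x.
Proof. by rewrite /trial sqrrN mulNr. Qed.

Lemma trial_dN q T x : trial_d q T (- x) = trial_d q T x.
Proof. by rewrite /trial_d sqrrN. Qed.

Lemma trial_residual q T N D x : zr T != 0 :> R ->
  zr T * zr D * ((x ^+ 3 - 4 * x) * trial_d q T x - trial_dd q T x)
    - zr T * zr N * trial q T x =
  x * zeval (zresidual T N D q) (x ^+ 2 / zr T).
Proof.
move=> T0; rewrite /zresidual !(zevalD, zevalZ, zeval_cons) !(zrN, zrM) /trial /trial_d /trial_dd zeval_slope.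
rewrite (zr_nat 0) (zr_nat 2) (zr_nat 4).
by field.
Qed.

End Trial.

(* Keeps conversion from unfolding the long coefficient lists, or the ten-digit constants under
   [zr], in the proofs below. *)
Local Opaque zr zslope zresidual upper_coefs lower_coefs zpos01 zeval.

Section TrialFunctions.
Context {R : realType}.

Lemma sqr_div_zr_itv (T : Z) (x : R) : 0 < zr T :> R -> `|x| <= Num.sqrt (zr T) ->
  0 <= x ^+ 2 / zr T <= 1.
Proof.
move=> T0 xT; rewrite divr_ge0 ?sqr_ge0 ?(ltW T0)//= ler_pdivrMr// mul1r.
by rewrite -(sqr_sqrtr (ltW T0)) -(real_normK (num_real x)) lerXn2r// nnegrE sqrtr_ge0.
Qed.

(** Relates the large constants to the form used in [CP_center], with only small unary numbers [a],
    [b], [c]; the equation between integers is left to binary computation. *)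
Lemma zr_const (z : Z) (a b c : nat) :
  z = Z.add (Z.mul (Z.of_nat a) (Z.pow (Z.of_nat 10) (Z.of_nat b))) (Z.of_nat c) ->
  zr z = a%:R * 10 ^+ b + c%:R :> R.
Proof.
move=> ->; rewrite zrD zrM !zr_nat; congr (_ * _ + _).
elim: b => [|b IHb]; first by rewrite expr0 -[LHS]/(zr (Z.of_nat 1)) zr_nat.
by rewrite (Nat2Z.inj_succ b) (Z.pow_succ_r _ _ (Nat2Z.is_nonneg b)) zrM IHb zr_nat exprS.
Qed.

Lemma zr_1e8 : zr 100000000 = 10 ^+ 8 :> R.
Proof.
rewrite (@zr_const 100000000 1 8 0); last by vm_compute.
by rewrite mul1r addr0.
Qed.

Lemma CP_upperE : CP_center + CP_err = zr 3358004265 / zr 100000000 :> R.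
Proof.
rewrite zr_1e8 (@zr_const 3358004265 3358 6 4265); last by vm_compute.
by rewrite /CP_center /CP_err -mulrDl -addrA -natrD.
Qed.

Lemma CP_upper_ge1 : 1 <= CP_center + CP_err :> R.
Proof.
have N0 : 0 < zr 100000000 :> R by rewrite zr_1e8.
have := @zr_le R 100000000 3358004265 isT; rewrite CP_upperE.
by move: (zr 100000000) (zr 3358004265) N0 => N D N0 ND; rewrite ler_pdivlMr// mul1r.
Qed.

Lemma CP_lowerE : CP_center - CP_err = zr 3358004219 / zr 100000000 :> R.
Proof.
rewrite zr_1e8 (@zr_const 3358004219 3358 6 4219); last by vm_compute.
by rewrite /CP_center /CP_err -mulrBl -addrA -natrB.
Qed.

Lemma upper_trial : exists (X : R) (f w dw : R -> R),
  [/\ 0 < X, 12 <= X ^+ 2, f 0 = 0,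
      (forall x : R, is_derive x 1 f (w x)) & (forall x : R, is_derive x 1 w (dw x))] /\
  [/\ continuous dw, (forall x, 0 <= x <= X -> 0 < w x),
      (forall x, 0 < x <= X -> 0 < f x),
      (forall x, 0 <= x <= X ->
        f x <= (CP_center + CP_err) * ((x ^+ 3 - 4 * x) * w x - dw x)) &
      f X <= (CP_center + CP_err) * ((X ^+ 3 - 4 * X) * w X)].
Proof.
have T12 : zr 12 = 12 :> R := zr_nat 12.
have T0 : 0 < zr 12 :> R by rewrite T12.
have N0 : 0 < zr 100000000 :> R by rewrite zr_1e8.
pose X : R := Num.sqrt (zr 12).
have X0 : 0 < X by rewrite sqrtr_gt0.
have XX : X ^+ 2 = 12 by rewrite sqr_sqrtr ?T12.
have itv x : 0 <= x <= X -> 0 <= x ^+ 2 / zr 12 <= 1.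
  by move=> /andP[x0 xX]; apply: sqr_div_zr_itv => //; rewrite ger0_norm.
exists X, (trial upper_coefs 12), (trial_d upper_coefs 12), (trial_dd upper_coefs 12).
split; split => //; rewrite ?XX//.
- by rewrite /trial mul0r.
- exact: is_derive_trial.
- exact: is_derive_trial_d.
- exact: continuous_trial_dd.
- move=> x /itv x01; have := zpos01P upper_slope_gt0 x01.
  rewrite zevalD zeval_cons zeval_nil mulr0 addr0 (zrN 1) (zr_nat 1) addrC subr_ge0.
  exact: lt_le_trans ltr01.
- move=> x /andP[x0 xX]; rewrite /trial mulr_gt0//.
  have x01 : 0 <= x ^+ 2 / zr 12 <= 1 by apply: itv; rewrite (ltW x0).
  have := zpos01P upper_coefs_gt0 x01.
  rewrite zevalD zeval_cons zeval_nil mulr0 addr0 (zrN 1) (zr_nat 1) addrC subr_ge0.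
  exact: lt_le_trans ltr01.
- move=> x xX; have := zpos01P upper_residual_ge0 (itv _ xX).
  case/andP: xX => x0 _ /(mulr_ge0 x0).
  rewrite -trial_residual ?gt_eqF// CP_upperE.
  move: (zr 100000000) N0 (zr 3358004265) => N N0 D.
  set f := trial _ _ _; set v := (_ - trial_dd _ _ _) => H.
  rewrite -mulrAC ler_pdivlMr// -(ler_pM2l T0) -subr_ge0; move: H.
  by congr (0 <= _); ring.
- have XT : X ^+ 2 / zr 12 = 1 by rewrite XX T12 divff.
  have -> : X ^+ 3 - 4 * X = X * 8 by rewrite exprS XX; ring.
  rewrite CP_upperE /trial /trial_d XT !zeval1.
  have := upper_endpoint => /Z.leb_le/Zle_minus_le_0.
  set b := foldr _ _ _; set a := foldr _ _ _ => H.
  have : 0 <= zr (Z.sub (Z.mul 3358004265 (Z.mul 8 b)) (Z.mul 100000000 a)) :> R.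
    by apply: zr_ge0; apply/Z.leb_le.
  rewrite -Z.add_opp_r zrD zrN !zrM (zr_nat 8) subr_ge0.
  move: (zr a) (zr b) (zr 100000000) N0 (zr 3358004265) => {H} a' b' N N0 D H.
  have := ler_wpM2l (ltW X0) H.
  rewrite -subr_ge0 => {}H; rewrite mulrAC ler_pdivlMr// -subr_ge0; move: H.
  by congr (0 <= _); ring.
Qed.

Lemma lower_trial : exists (X : R) (f w dw : R -> R),
  [/\ 0 < X, forall x, f (- x) = - f x,
      (forall x : R, is_derive x 1 f (w x)) & (forall x : R, is_derive x 1 w (dw x))] /\
  [/\ continuous dw, w X = 0, w (- X) = 0, w 0 != 0 &
      (forall x, 0 <= x <= X -> 0 <= f x)] /\
      (forall x, `|x| <= X ->
        (CP_center - CP_err) * (f x * ((x ^+ 3 - 4 * x) * w x - dw x)) <= f x ^+ 2).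
Proof.
have T13 : zr 13 = 13 :> R := zr_nat 13.
have T0 : 0 < zr 13 :> R by rewrite T13.
have N0 : 0 < zr 100000000 :> R by rewrite zr_1e8.
pose X : R := Num.sqrt (zr 13).
have X0 : 0 < X by rewrite sqrtr_gt0.
have XX : X ^+ 2 = 13 by rewrite sqr_sqrtr ?T13.
have itv x : `|x| <= X -> 0 <= x ^+ 2 / zr 13 <= 1 by exact: sqr_div_zr_itv.
have wX : trial_d lower_coefs 13 X = 0.
  by rewrite /trial_d XX T13 divff// zeval1 lower_endpoint (zr_nat 0).
exists X, (trial lower_coefs 13), (trial_d lower_coefs 13), (trial_dd lower_coefs 13).
split; [|split]; [split => //|split => //|].
- exact: trialN.
- exact: is_derive_trial.
- exact: is_derive_trial_d.
- exact: continuous_trial_dd.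
- by rewrite trial_dN.
- by rewrite /trial_d expr0n mul0r zeval_slope !mul0r addr0 zeval0 zr_eq0 lower_coefs_head.
- move=> x /andP[x0 xX]; rewrite /trial mulr_ge0//.
  by apply: (zpos01P lower_coefs_ge0); apply: itv; rewrite ger0_norm.
- move=> x xX; have := zpos01P lower_residual_le0 (itv _ xX).
  rewrite zevalZ (zrN 1) (zr_nat 1) mulN1r oppr_ge0 => r0.
  have q0 := zpos01P lower_coefs_ge0 (itv _ xX).
  (* The subsolution inequality multiplied by [f]: the odd factors [x] combine into [x^2], so
     negative [x] need no separate treatment. *)
  have : x ^+ 2 * zeval lower_coefs (x ^+ 2 / zr 13) *
     zeval (zresidual 13 100000000 3358004219 lower_coefs) (x ^+ 2 / zr 13) <= 0.
    by rewrite mulr_ge0_le0// mulr_ge0 ?sqr_ge0.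
  have -> : forall a b : R, x ^+ 2 * a * b = (x * a) * (x * b) by move=> a b; ring.
  rewrite -[x * zeval lower_coefs _]/(trial lower_coefs 13 x) -trial_residual ?gt_eqF//.
  rewrite CP_lowerE; move: (zr 100000000) N0 (zr 3358004219) => N N0 D.
  set f := trial _ _ _; set v := (_ - trial_dd _ _ _) => H.
  rewrite -(ler_pM2l N0) -(ler_pM2l T0) -subr_le0; move: H.
  by congr (_ <= 0); field; rewrite gt_eqF.
Qed.

End TrialFunctions.

Theorem mainTheorem13 (R : realType) :
  exists CP : R,
    poincare_const CP /\
    (forall C : R, poincare_const C -> CP <= C) /\
    CP_center - CP_err <= CP <= CP_center + CP_err.
Proof.
apply: best_poincare_const.
- have [X [f [w [dw [[X0 X12 f0 df d2f] [cdw w0 f_gt0 super superX]]]]]] := @upper_trial R.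
  apply: hardy_poincare => u du.
  exact: (supersolution_hardy X0 X12 f0 CP_upper_ge1 df d2f cdw w0 f_gt0 super superX).
- have [X [f [w [dw [[X0 fN df d2f] [[cdw wX wNX w0 f_ge0] sub]]]]]] := @lower_trial R.
  move=> C; exact: (subsolution_poincare X0 fN df d2f cdw wX wNX w0 f_ge0 sub).
Qed.
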